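(* Let $R$ be a Cohen-Macaulay local ring and let $M$ and $N$ be finitely generated $R$-modules such that $M=\Omega_R L$ for some maximal Cohen-Macaulay $R$-module $L$. If $\operatorname{pd}_R(M\otimes_R N)<\infty$, then $M=0$ or $N=0$.
   Context: Rings are commutative Noetherian and modules are finitely generated. $\operatorname{pd}_R$ denotes projective dimension, with $\operatorname{pd}_R(0)=-\infty$. For a module $L$ over a local ring $R$, $\Omega_R L$ denotes the first syzygy of $L$ in its minimal free resolution, i.e. the kernel of a surjection $R^{\oplus \mu_R(L)}\to L$, where $\mu_R(L)$ is the minimal number of generators of $L$. An $R$-module $L$ is maximal Cohen-Macaulay if $\operatorname{depth}_R(L)=\dim(R)$. *)

(* Defs.v *)
From HB Require Import structures.
From mathcomp Require Import all_boot all_order all_algebra generic_quotient.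
From mathcomp Require Import boolp classical_sets constructive_ereal.

Set Implicit Arguments.
Unset Strict Implicit.
Unset Printing Implicit Defensive.

Import GRing.Theory.
Local Open Scope ring_scope.
Local Open Scope classical_set_scope.
Local Open Scope quotient_scope.

Section Generators.
Variable R : comNzRingType.

Definition zero_module (V : lmodType R) : Prop := forall x : V, x = 0.

Definition span (V : lmodType R) n (v : 'I_n -> V) : set V :=
  [set x | exists c : 'I_n -> R, x = \sum_(i < n) c i *: v i].

Definition generated_by (V : lmodType R) (n : nat) : Prop :=
  exists v : 'I_n -> V, span v = setT.

Definition finitely_generated (V : lmodType R) : Prop :=
  exists n, generated_by V n.

(* Only meaningful for a finitely generated module, where it is the least
   number of generators; the default value is 0. *)
Definition mu (V : lmodType R) : nat :=
  infimum 0%N [set n | generated_by V n].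

End Generators.

Section Rings.
Variable R : comNzRingType.

(* The ideals of R, the unit ideal included, are the submodules of R^o. *)
Definition noetherian : Prop :=
  forall I : {pred R^o}, submod_closed I ->
    exists n (a : 'I_n -> R^o), [set` I] = span a.

(* [idealr_closed] means proper ideal: it contains the condition that 1 is not
   in the ideal. *)
Definition prime_ideal (P : {pred R}) : Prop :=
  idealr_closed P /\ prime_idealr_closed P.

Definition maximal_ideal (m : {pred R}) : Prop :=
  idealr_closed m /\
  forall J : {pred R}, idealr_closed J -> {subset m <= J} -> J =i m.

Definition local_ring (m : {pred R}) : Prop :=
  maximal_ideal m /\ forall m' : {pred R}, maximal_ideal m' -> m' =i m.

Definition prime_chain (n : nat) (P : nat -> {pred R}) : Prop :=
  (forall i, (i <= n)%N -> prime_ideal (P i)) /\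
  (forall i, (i < n)%N ->
     {subset P i <= P i.+1} /\ ~ {subset P i.+1 <= P i}).

Definition krull_dim : \bar int :=
  supremum -oo%E
    [set (n%:Z)%:E%E | n in [set n | exists P, prime_chain n P]].

End Rings.

Section Depth.
Variables (R : comNzRingType) (m : {pred R}).

(* (s_0, ..., s_(k-1)) L *)
Definition seq_submodule (L : lmodType R) (s : seq R) : set L :=
  [set v | exists c : nat -> L, v = \sum_(i < size s) s`_i *: c i].

(* s_i is a nonzerodivisor on L / (s_0, ..., s_(i-1)) L for all i, and
   L / (s_0, ..., s_(k-1)) L <> 0. *)
Definition regular_sequence (L : lmodType R) (s : seq R) : Prop :=
  [/\ {subset s <= m},
      forall i, (i < size s)%N -> forall v : L,
        seq_submodule (take i s) (s`_i *: v) -> seq_submodule (take i s) v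
    & exists v : L, ~ seq_submodule s v].

(* A nonzero module has at least the empty regular sequence, while the zero
   module has none: the default value +oo is the convention depth 0 = +oo. *)
Definition depth (L : lmodType R) : \bar int :=
  supremum +oo%E [set ((size s)%:Z)%:E%E | s in regular_sequence L].

Definition maximal_cohen_macaulay (L : lmodType R) : Prop :=
  depth L = krull_dim R.

Definition cohen_macaulay_ring : Prop := depth R^o = krull_dim R.

End Depth.

Section Homological.
Variable R : comNzRingType.

Definition is_surjective (A B : Type) (f : A -> B) : Prop :=
  forall y, exists x, f x = y.

(* A --f--> B --g--> C is exact at B *)
Definition exact_at (A B C : lmodType R) (f : A -> B) (g : B -> C) : Prop :=
  forall y, g y = 0 <-> exists x, f x = y.

Definition projective (P : lmodType R) : Prop :=
  forall (A B : lmodType R) (g : {linear A -> B}) (f : {linear P -> B}),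
    is_surjective g -> exists h : {linear P -> A}, forall x, g (h x) = f x.

Definition projective_resolution (M : lmodType R) (P : nat -> lmodType R)
    (d : forall i, {linear P i.+1 -> P i}) (e : {linear P 0%N -> M}) : Prop :=
  [/\ forall i, projective (P i), is_surjective e, exact_at (d 0%N) e
    & forall i, exact_at (d i.+1) (d i)].

Definition has_resolution_of_length (M : lmodType R) (n : nat) : Prop :=
  exists (P : nat -> lmodType R) (d : forall i, {linear P i.+1 -> P i})
    (e : {linear P 0%N -> M}),
    projective_resolution d e /\ forall i, (n < i)%N -> zero_module (P i).

Definition pd (M : lmodType R) : \bar int :=
  if `[< zero_module M >] then -oo%E
  else infimum +oo%E [set (n%:Z)%:E%E | n in has_resolution_of_length M].

(* M is isomorphic to the kernel of a surjection R^(mu L) -> L *)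
Definition is_first_syzygy (M L : lmodType R) : Prop :=
  exists (i : {linear M -> 'rV[R]_(mu L)}) (p : {linear 'rV[R]_(mu L) -> L}),
    [/\ injective i, exact_at i p & is_surjective p].

Definition is_tensor_product (M N T : lmodType R)
    (t : {bilinear M -> N -> T}) : Prop :=
  forall (P : lmodType R) (f : {bilinear M -> N -> P}),
    exists g : {linear T -> P},
      (forall x y, g (t x y) = f x y) /\
      (forall g' : {linear T -> P}, (forall x y, g' (t x y) = f x y) ->
         g' =1 g).

End Homological.

(* Existence of the tensor product: formal sums of pairs, two of them being
   identified when no bilinear map distinguishes them. *)
Section TensorProduct.
Variables (R : comNzRingType) (M N : lmodType R).

Let eval (P : lmodType R) (f : {bilinear M -> N -> P}) (s : seq (M * N)) : P :=
  \sum_(u <- s) f u.1 u.2.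

Let sim (s s' : seq (M * N)) : bool :=
  `[< forall (P : lmodType R) (f : {bilinear M -> N -> P}),
        eval f s = eval f s' >].

Let sim_equiv : equiv_class_of sim.
Proof.
split=> [s|s s'|s' s s'']; first exact/asboolP.
  by apply/asboolP/asboolP => h P f; rewrite h.
by move=> /asboolP h /asboolP h'; apply/asboolP => P f; rewrite h h'.
Qed.

Let simr : equiv_rel (seq (M * N)) := EquivRelPack sim_equiv.


Definition tensor : Type := {eq_quot simr}.

HB.instance Definition _ := Choice.on tensor.
HB.instance Definition _ := Quotient.on tensor.

Let tens (s : seq (M * N)) : tensor := \pi_tensor s.

Let tens_eq s s' :
  (forall (P : lmodType R) (f : {bilinear M -> N -> P}),
     eval f s = eval f s') -> tens s = tens s'.
Proof. by move=> h; apply/eqquotP/asboolP. Qed.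

Let evalK (P : lmodType R) (f : {bilinear M -> N -> P}) s :
  eval f (repr (tens s)) = eval f s.
Proof.
have /eqquotP/asboolP : repr (tens s) = s %[mod tensor] by rewrite reprK.
exact.
Qed.

Let tensE (x : tensor) : x = tens (repr x).
Proof. by rewrite /tens reprK. Qed.

Let zscale (a : R) (s : seq (M * N)) := [seq (a *: u.1, u.2) | u <- s].

Let eval_cat (P : lmodType R) (f : {bilinear M -> N -> P}) s s' :
  eval f (s ++ s') = eval f s + eval f s'.
Proof. exact: big_cat. Qed.

Let eval_scale (P : lmodType R) (f : {bilinear M -> N -> P}) a s :
  eval f (zscale a s) = a *: eval f s.
Proof.
rewrite /eval big_map scaler_sumr; apply: eq_bigr => u _ /=.
exact: linearZl_LR.
Qed.

Let eval_nil (P : lmodType R) (f : {bilinear M -> N -> P}) : eval f [::] = 0.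
Proof. exact: big_nil. Qed.

Let add (x y : tensor) : tensor := tens (repr x ++ repr y).
Let opp (x : tensor) : tensor := tens (zscale (-1) (repr x)).
Let scale (a : R) (x : tensor) : tensor := tens (zscale a (repr x)).
Let evE := (evalK, eval_cat, eval_scale, eval_nil).

Let addA : associative add.
Proof. by move=> x y z; apply: tens_eq => P f; rewrite !evE addrA. Qed.
Let addC : commutative add.
Proof. by move=> x y; apply: tens_eq => P f; rewrite !evE addrC. Qed.
Let add0 : left_id (tens [::]) add.
Proof.
by move=> x; rewrite [RHS]tensE; apply: tens_eq => P f; rewrite !evE add0r.
Qed.
Let addN : left_inverse (tens [::]) opp add.
Proof.
by move=> x; apply: tens_eq => P f; rewrite !evE scaleN1r addNr.
Qed.

HB.instance Definition _ := GRing.isZmodule.Build tensor addA addC add0 addN.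

Let scaleA a b x : scale a (scale b x) = scale (a * b) x.
Proof. by apply: tens_eq => P f; rewrite !evE scalerA. Qed.
Let scale1 : left_id 1 scale.
Proof.
by move=> x; rewrite [RHS]tensE; apply: tens_eq => P f; rewrite !evE scale1r.
Qed.
Let scaleDr : right_distributive scale +%R.
Proof. by move=> a x y; apply: tens_eq => P f; rewrite !evE scalerDr. Qed.
Let scaleDl x : {morph scale^~ x : a b / a + b}.
Proof. by move=> a b; apply: tens_eq => P f; rewrite !evE scalerDl. Qed.

HB.instance Definition _ :=
  GRing.Zmodule_isLmodule.Build R tensor scaleA scale1 scaleDr scaleDl.

Definition tensor_mk (x : M) (y : N) : tensor := tens [:: (x, y)].

Let eval1 (P : lmodType R) (f : {bilinear M -> N -> P}) x y :
  eval f [:: (x, y)] = f x y.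
Proof. exact: big_seq1. Qed.

Let tensor_mk_bilinear : bilinear_for *:%R *:%R tensor_mk.
Proof.
split=> [y|x] a u v; apply: tens_eq => P f; rewrite !(evE, eval1).
  exact: linearPl.
exact: linearPr.
Qed.

HB.instance Definition _ :=
  bilinear_isBilinear.Build R M N tensor *:%R *:%R tensor_mk
    tensor_mk_bilinear.

Lemma tensor_is_tensor_product :
  is_tensor_product (tensor_mk : {bilinear M -> N -> tensor}).
Proof.
move=> P f.
pose g0 (x : tensor) : P := eval f (repr x).
have g0lin : linear g0 by move=> a x y; rewrite /g0 !evE.
pose gM := GRing.isLinear.Build R tensor P *:%R g0 g0lin.
pose g : {linear tensor -> P} := HB.pack g0 gM.
exists g; split=> [x y|g' g'E x]; first by rewrite /= /g0 evE eval1.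
rewrite /= /g0; rewrite [LHS](_ : _ = g' (tens (repr x))); last by rewrite -tensE.
elim: (repr x) => [|[a b] s IHs].
  by rewrite eval_nil -(linear0 g').
rewrite -cat1s eval_cat eval1 -IHs -g'E -linearD; congr (g' _).
by apply: tens_eq => Q h; rewrite !evE.
Qed.

End TensorProduct.

(* Main.v *)
From HB Require Import structures.
Require Import Defs.
From mathcomp Require Import all_boot all_order all_algebra.
From mathcomp Require Import generic_quotient ring_quotient.
From mathcomp Require Import boolp classical_sets functions constructive_ereal.
From mathcomp Require freeg.

(** Suppose that M and N are both nonzero and put T = M (x) N.

    The picture to keep in mind is the case of a Gorenstein ring.  There
    Ext^1(L, T) = 0 as soon as L is maximal Cohen-Macaulay and T has finite
    projective dimension, so every map f : M -> T extends along the inclusion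
    M -> F = R^(mu L).  The syzygy M lies in mF by minimality of F -> L, hence
    f(M) lies in mT.  Applied to the maps f = (- (x) y), this says that T = mT,
    which is absurd because M/mM and N/mN are nonzero.

    Over an arbitrary Cohen-Macaulay ring Ext^1(L, R) may be nonzero, and the
    argument is repaired by tensoring with an injective module over a quotient
    R/(x) of depth zero.  Choose a sequence x that is regular on R and on L
    such that R/(x) has a nonzero socle element s ([common_regular_sequence]);
    this is where the equality depth R = depth L enters.  Let E be an
    injective module over R/(x), with e0 in E such that s e0 <> 0
    ([relatively_injective_module]); it consists of the additive maps from
    R/(x) to Q/Z.  If x is regular on G and 0 -> G' -> F -> G -> 0 is exact with
    F free of finite rank, then G'/xG' -> F/xF is still injective, so every map
    G' -> E extends to F ([syzygy_regular]); moreover x is again regular on G'.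

    The heart of the proof is [extension_along_syzygy]: for f : M -> T and e in
    E, the map M -> E (x) T sending z to e (x) f(z) extends to F.  It is proved
    by induction on the length of a projective resolution of T.  The induction
    works with E (x) T itself rather than with the complex E (x) P, which has
    homology in general.  As M lies in mF, it follows that e0 (x) f(z) lies in
    m(E (x) T) for all z in M.

    Finally choose functions phi : M -> R and psi : N -> R that are linear
    modulo m and take unit values ([residue_coordinate]), and let Q be the
    quotient of E by the elements annihilated by s.  As sm is contained in (x)
    and (x)E = 0, the ideal m kills Q.  The rule sending e (x) (y (x) z) to the
    class of phi(y)psi(z)e defines a linear map E (x) T -> Q, which therefore
    vanishes on m(E (x) T).  It does not vanish on e0 (x) (y (x) z) when phi(y)
    and psi(z) are units, a contradiction. *)

Set Implicit Arguments.
Unset Strict Implicit.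
Unset Printing Implicit Defensive.

Import GRing.Theory Num.Theory.
Local Open Scope ring_scope.
Local Open Scope classical_set_scope.

(** * Linear maps, submodules and quotients *)

Section LinearMaps.
Variable R : comNzRingType.
Implicit Types A B C V : lmodType R.

Lemma linear_of A B (f : A -> B) : linear f ->
  exists g : {linear A -> B}, g =1 f.
Proof.
move=> fL; pose gM := GRing.isLinear.Build R A B *:%R f fL.
by pose g : {linear A -> B} := HB.pack f gM; exists g.
Qed.

Lemma surj_section A B (q : A -> B) : is_surjective q ->
  exists s : B -> A, cancel s q.
Proof. by move=> qS; have [s sK] := boolp.choice qS; exists s. Qed.

Lemma factor_through_surj A B C (q : {linear A -> B}) (w : {linear A -> C}) :
    is_surjective q -> (forall a, q a = 0 -> w a = 0) ->
  exists v : {linear B -> C}, forall a, v (q a) = w a.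
Proof.
move=> /surj_section [s sK] kerq.
have ws a b : q a = q b -> w a = w b.
  move=> qab; apply/subr0_eq; rewrite -linearB; apply: kerq.
  by rewrite linearB qab subrr.
have [|v vE] := @linear_of B C (w \o s).
  by move=> a x y /=; rewrite -linearP; apply: ws; rewrite linearP !sK.
by exists v => a; rewrite vE /=; apply: ws; rewrite sK.
Qed.

Lemma factor_through_inj A B C (i : {linear A -> B}) (w : {linear C -> B}) :
    injective i -> (forall c, exists a, i a = w c) ->
  exists v : {linear C -> A}, forall c, i (v c) = w c.
Proof.
move=> i_inj /boolp.choice [v vE]; have [|v' v'E] := @linear_of C A v.
  by move=> a x y; apply: i_inj; rewrite linearP !vE linearP.
by exists v' => c; rewrite v'E.
Qed.

Lemma row_map n V (v : 'I_n -> V) :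
  exists g : {linear 'rV[R]_n -> V}, forall x, g x = \sum_j x 0 j *: v j.
Proof.
have [|g gE] := @linear_of 'rV[R]_n V (fun x => \sum_j x 0 j *: v j);
  last by exists g.
move=> a x y; rewrite scaler_sumr -big_split; apply: eq_bigr => j _ /=.
by rewrite !mxE scalerDl scalerA.
Qed.

Lemma row_mapE n V (g : {linear 'rV[R]_n -> V}) x :
  g x = \sum_j x 0 j *: g (delta_mx 0 j).
Proof.
by rewrite {1}[x]row_sum_delta linear_sum; apply: eq_bigr => j _;
  rewrite linearZ.
Qed.

Lemma row_projective n A B (q : {linear A -> B}) (f : {linear 'rV[R]_n -> B}) :
  is_surjective q -> exists h : {linear 'rV[R]_n -> A}, forall x, q (h x) = f x.
Proof.
move=> /surj_section [s sK].
have [h hE] := row_map (fun j => s (f (delta_mx 0 j))); exists h => x.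
rewrite hE linear_sum row_mapE; apply: eq_bigr => j _.
by rewrite linearZ /= sK.
Qed.

Lemma finitely_generatedP V : finitely_generated V <->
  exists n (g : {linear 'rV[R]_n -> V}), is_surjective g.
Proof.
split=> [[n [v vT]]|[n [g gS]]].
  exists n; have [g gE] := row_map v; exists g => x.
  have : Defs.span v x by rewrite vT.
  by move=> [c ->]; exists (\row_j c j); rewrite gE; apply: eq_bigr => j _;
    rewrite mxE.
exists n, (fun j => g (delta_mx 0 j)); apply/seteqP; split=> // x _.
by have [y <-] := gS x; exists (fun j => y 0 j); rewrite -row_mapE.
Qed.

End LinearMaps.

Section Submodules.
Variables (R : pzRingType) (V : lmodType R).

Definition submodule (U : set V) : Prop :=
  U 0 /\ forall a u v, U u -> U v -> U (a *: u + v).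

Section Closure.
Variables (U : set V) (subU : submodule U).

Lemma submod0 : U 0. Proof. exact: subU.1. Qed.
Lemma submodD u v : U u -> U v -> U (u + v).
Proof. by move=> Uu Uv; rewrite -[u]scale1r; apply: subU.2. Qed.
Lemma submodZ a u : U u -> U (a *: u).
Proof. by move=> Uu; rewrite -[_ *: _]addr0; apply: subU.2 => //;
  apply: submod0. Qed.
Lemma submodN u : U u -> U (- u).
Proof. by move=> Uu; rewrite -scaleN1r; apply: submodZ. Qed.
Lemma submodB u v : U u -> U v -> U (u - v).
Proof. by move=> Uu Uv; apply: submodD => //; apply: submodN. Qed.
Lemma submodDr u v : U u -> U (v + u) -> U v.
Proof. by move=> Uu Uvu; rewrite -(addrK u v); apply: submodB. Qed.
Lemma submod_sum (I : Type) (r : seq I) (P : pred I) (F : I -> V) :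
  (forall i, P i -> U (F i)) -> U (\sum_(i <- r | P i) F i).
Proof.
by move=> UF; elim/big_rec: _ => [|i x Pi Ux];
  [apply: submod0|apply: submodD => //; apply: UF].
Qed.

Definition submod_pred : {pred V} := [pred v | `[< U v >]].
Lemma submod_predP : submod_closed submod_pred.
Proof.
split; first by apply/asboolP; apply: submod0.
by move=> a u v /asboolP Uu /asboolP Uv; apply/asboolP/subU.2.
Qed.
End Closure.

End Submodules.

Section QuotientsAndSubmodules.
Variable (R : pzRingType) (V : lmodType R).

Section QuotientModule.
Variables (U : set V) (subU : submodule U).

Let zmodU : zmod_closed (submod_pred U).
Proof.
split=> [|u v /asboolP Uu /asboolP Uv]; apply/asboolP; first exact: submod0.
exact: submodB.
Qed.
Let UM := GRing.isZmodClosed.Build V (submod_pred U) zmodU.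
Let Uz : zmodClosed V := HB.pack (submod_pred U) UM.

Definition quotient_module := Quotient.quot Uz.
HB.instance Definition _ := GRing.Zmodule.on quotient_module.

Let proj (u : V) : quotient_module := \pi_(Quotient.quot Uz)%qT u.
Let sc (a : R) (x : quotient_module) : quotient_module := proj (a *: repr x).
Let projE u v : proj u = proj v <-> U (u - v).
Proof.
have UE : `[< U (u - v) >] = (proj u == proj v) := Quotient.idealrBE Uz u v.
by split=> [/eqP|/asboolP]; [rewrite -UE => /asboolP|rewrite UE => /eqP].
Qed.
Let projK (x : quotient_module) : proj (repr x) = x. Proof. exact: reprK. Qed.
Let projD u v : proj (u + v) = proj u + proj v.
Proof. by rewrite /proj [LHS]Quotient.pi_add. Qed.
Let sc_proj a u : sc a (proj u) = proj (a *: u).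
Proof.
by apply/projE; rewrite -scalerBr; apply: submodZ => //; apply/projE;
  rewrite projK.
Qed.
Let sA a b x : sc a (sc b x) = sc (a * b) x.
Proof. by rewrite -(projK x) !sc_proj scalerA. Qed.
Let s1 : left_id 1 sc.
Proof. by move=> x; rewrite -(projK x) sc_proj scale1r. Qed.
Let sDr : right_distributive sc +%R.
Proof.
by move=> a x y; rewrite -(projK x) -(projK y) !(sc_proj, =^~ projD) scalerDr.
Qed.
Let sDl x : {morph sc^~ x : a b / a + b}.
Proof. by move=> a b; rewrite -(projK x) !sc_proj scalerDl projD. Qed.
HB.instance Definition _ :=
  GRing.Zmodule_isLmodule.Build R quotient_module sA s1 sDr sDl.

Lemma quotient_exists :
  exists (W : lmodType R) (p : {linear V -> W}),
    is_surjective p /\ forall v, p v = 0 <-> U v.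
Proof.
have pL : linear proj by move=> a u v; rewrite projD -sc_proj.
pose pM := GRing.isLinear.Build R V quotient_module *:%R proj pL.
pose p : {linear V -> quotient_module} := HB.pack proj pM.
exists quotient_module, p; split=> [x|v]; first by exists (repr x);
  rewrite /= projK.
by rewrite -[v in U v]subr0 -projE -[proj 0]/(p 0) linear0.
Qed.
End QuotientModule.

Section SubmoduleType.
Variable U : submodClosed V.
Inductive submodule_type := Submodule_type v of v \in U.
Definition submodule_val x := let: Submodule_type v _ := x in v.
HB.instance Definition _ := [isSub for submodule_val].
HB.instance Definition _ := [Choice of submodule_type by <:].
HB.instance Definition _ := [SubChoice_isSubLmodule of submodule_type by <:].
End SubmoduleType.

(** Stated as an existence result, like [quotient_exists], so that the carrier
    of the submodule never has to be unfolded. *)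
Lemma submodule_exists (U : set V) : submodule U ->
  exists (W : lmodType R) (i : {linear W -> V}),
    injective i /\ forall v, U v <-> exists w, i w = v.
Proof.
move=> subU; pose UM := GRing.isSubmodClosed.Build R V (submod_pred U)
  (submod_predP subU).
pose U' : submodClosed V := HB.pack (submod_pred U) UM.
exists (submodule_type U'), (\val : {linear submodule_type U' -> V}).
split=> [|v]; first exact: val_inj.
split=> [/asboolP Uv|[[w wU] <-]]; last by apply/asboolP.
by exists (Submodule_type (Uv : v \in U')).
Qed.
End QuotientsAndSubmodules.

(** [Zorn_bigcup] also asks for the union of the empty chain; restricting to
    the sets above a given [A0] removes that degenerate case. *)
Lemma Zorn_above T (P : set (set T)) (A0 : set T) :
    P A0 ->
    (forall F, F `<=` P -> F !=set0 -> total_on F subset ->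
      P (\bigcup_(X in F) X)) ->
  exists A, [/\ P A, A0 `<=` A & forall B, P B -> A `<=` B -> B `<=` A].
Proof.
move=> PA0 PU; pose Q : set (set T) := [set X | X = set0 \/ P X /\ A0 `<=` X].
have [F FQ totF|A [QA Amax]] := @Zorn_bigcup _ Q.
  have [[X0 [FX0 [PX0 AX0]]]|noX] := pselect
    (exists X, F X /\ P X /\ A0 `<=` X); last first.
    left; rewrite -subset0 => v [X FX Xv]; have [X_0|PX] := FQ X FX.
      by rewrite X_0 in Xv.
    by case: noX; exists X.
  right; pose G := F `&` [set X | P X /\ A0 `<=` X].
  have -> : \bigcup_(X in F) X = \bigcup_(X in G) X.
    apply/seteqP; split=> v [X]; last by move=> [FX _] Xv; exists X.
    move=> FX Xv; exists X => //; split=> //.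
    by have [X_0|] := FQ X FX => //; rewrite X_0 in Xv.
  split; last by move=> v /AX0 X0v; exists X0.
  apply: PU => [X [_ []] //||X Y [FX _] [FY _]]; last exact: totF.
  by exists X0.
have A_max B : P B -> A0 `<=` B -> A `<=` B -> B `<=` A.
  move=> PB A0B AB v Bv; apply: contrapT => nAv; apply: (Amax B); last by right.
  by split=> // /(_ v Bv).
case: QA => [A_0|[PA A0A]]; last first.
  by exists A; split=> // B PB AB; apply: A_max => //; apply: subset_trans AB.
exists A0; split=> // B PB AB v Bv; have := A_max B PB AB.
by rewrite A_0 => /(_ (@sub0set _ _) v Bv).
Qed.

(** * Noetherian modules *)

Section Noetherian.
Variable R : comNzRingType.
Implicit Types V W : lmodType R.

(** The maximal condition is the form of noetherianity that passes to products
    and quotients without mentioning generators. *)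
Definition noetherian_module V : Prop := forall C : set (set V),
  C `<=` @submodule R V -> C !=set0 ->
  exists U, C U /\ forall U', C U' -> U `<=` U' -> U' `<=` U.

Lemma chain_contains_family V (F : set (set V)) n (a : 'I_n -> V) X0 :
  total_on F subset -> F X0 -> (forall k, (\bigcup_(X in F) X) (a k)) ->
  exists2 X, F X & forall k, X (a k).
Proof.
move=> totF FX0; elim: n a => [|n IHn] a aF; first by exists X0 => // -[].
have [X FX Xa] := IHn (fun k => a (lift ord0 k)) (fun k => aF _).
have [Y FY Ya] := aF ord0.
have [XY|YX] := totF X Y FX FY.
  by exists Y => // k; case: (unliftP ord0 k) => [j|] ->//; apply/XY/Xa.
by exists X => // k; case: (unliftP ord0 k) => [j|] ->; [apply: Xa|apply: YX].
Qed.

(** The union of a chain of ideals is finitely generated, and by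
    [chain_contains_family] its generators lie in one member of the chain,
    which is then the whole union. *)
Lemma noetherian_ring_module : noetherian R -> noetherian_module R^o.
Proof.
move=> R_noeth C Csub [U0 CU0].
have [F FC [X0 FX0] totF|U [CU _ Umax]] := Zorn_above CU0; last by exists U.
set I := \bigcup_(X in F) X.
have Isub : submodule I.
  split=> [|a u v [X FX Xu] [Y FY Yv]].
    by exists X0 => //; apply: (Csub _ (FC _ FX0)).1.
  have [XY|YX] := totF X Y FX FY.
    by exists Y => //; apply: (Csub _ (FC _ FY)).2 => //; apply: XY.
  by exists X => //; apply: (Csub _ (FC _ FX)).2 => //; apply: YX.
have [n [a Ia]] := R_noeth _ (submod_predP Isub).
have {}Ia : I = Defs.span a.
  rewrite -Ia; apply/seteqP.
  by split=> v /=; [move=> Iv; apply/asboolP|move/asboolP].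
have [//|k|X FX Xa] := chain_contains_family (a := a) (X0 := X0) totF.
  rewrite -/I Ia; exists (fun j => (j == k)%:R).
  rewrite (bigD1 k) //= eqxx scale1r big1 ?addr0 // => j /negPf ->.
  by rewrite scale0r.
suff -> : I = X by apply: FC.
apply/seteqP; split=> v; last by move=> Xv; exists X.
rewrite Ia => -[c ->]; apply: submod_sum => [|j _]; first exact/Csub/FC.
by apply: submodZ; [apply/Csub/FC|apply: Xa].
Qed.

Lemma noetherian_module_surj V W (q : {linear V -> W}) : is_surjective q ->
  noetherian_module V -> noetherian_module W.
Proof.
move=> qS nV C Csub [U0 CU0].
pose D : set (set V) := [set q @^-1` U | U in C].
have [|_ [[U CU <-] Umax]] := nV D _ (ex_intro _ _ (imageP _ CU0)).
  move=> _ [U CU <-]; have [U_0 UP] := Csub U CU.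
  by split=> [|a u v Uu Uv]; rewrite /= ?linear0 // linearP; apply: UP.
exists U; split=> // U' CU' UU' w U'w; have [v vw] := qS w; rewrite -vw.
by apply: (Umax (q @^-1` U')); [exists U'|move=> x; apply: UU'|rewrite /= vw].
Qed.

(** A submodule [U] of [V * W] is determined, among the submodules containing
    it, by its projection to [V] and its intersection with [W]; both are
    maximized in turn. *)
Lemma noetherian_module_prod V W : noetherian_module V -> noetherian_module W ->
  noetherian_module (V * W)%type.
Proof.
move=> nV nW C Csub [U0 CU0].
pose p1 (U : set (V * W)%type) : set V := [set v | exists w, U (v, w)].
pose k2 (U : set (V * W)%type) : set W := [set w | U (0, w)].
have [|_ [[U1 CU1 <-] U1max]] := nV (p1 @` C) _ (ex_intro _ _ (imageP _ CU0)).
  move=> _ [U CU <-]; have [U_0 UP] := Csub U CU.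
  split=> [|a u v [w Uuw] [w' Uvw']]; first by exists 0.
  by exists (a *: w + w'); exact: (UP a _ _ Uuw Uvw').
pose D := C `&` [set U | p1 U1 `<=` p1 U].
have [||_ [[U [CU U1U] <-] Umax]] := nW (k2 @` D).
- move=> _ [U [CU _] <-]; have [U_0 UP] := Csub U CU; split=> //= a u v Uu Uv.
  rewrite /k2 /=; suff <- : a *: ((0 : V), u) + ((0 : V), v) = (0, a *: u + v)
    by apply: UP.
  by congr (_, _); rewrite /= scaler0 addr0.
- by exists (k2 U1), U1; split.
exists U; split=> // U' CU' UU' [v w] U'vw.
have U'D : D U' by split=> // x /U1U [y /UU']; exists y.
have [w' U1vw'] : p1 U1 v by apply: (U1max (p1 U'));
  [exists U'|exact: U'D.2|exists w].
have [w2 Uvw2] := U1U v (ex_intro _ w' U1vw').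
have Uk : k2 U (w - w2).
  apply: (Umax (k2 U')); [by exists U'|by move=> x; apply: UU'|].
  rewrite /k2 /=; suff <- : (v, w) - (v, w2) = (0, w - w2).
    by apply: submodB (UU' _ Uvw2) => //; apply: Csub.
  by congr (_, _); rewrite /= subrr.
suff <- : (0, w - w2) + (v, w2) = (v, w) by apply: submodD => //; apply: Csub.
by congr (_, _); rewrite /= ?add0r ?subrK.
Qed.

Lemma noetherian_module_row n : noetherian_module R^o ->
  noetherian_module 'rV[R]_n.
Proof.
move=> nR; elim: n => [|n IHn].
  move=> C Csub [U CU]; exists U; split=> // U' _ _ v _.
  by rewrite [v]thinmx0; apply: (Csub U CU).1.
rewrite -[n.+1]/(1 + n)%N.
have [|q qE] := @linear_of R (R^o * 'rV[R]_n)%type 'rV[R]_(1 + n)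
    (fun x => row_mx (x.1 : R)%:M x.2).
  move=> a x y /=; rewrite scale_row_mx add_row_mx scale_scalar_mx.
  by rewrite -raddfD.
apply: (noetherian_module_surj (q := q)); last exact: noetherian_module_prod.
move=> y; exists (lsubmx y 0 0, rsubmx y); rewrite qE /=.
by rewrite -mx11_scalar hsubmxK.
Qed.

Lemma noetherian_module_fg V : noetherian_module R^o -> finitely_generated V ->
  noetherian_module V.
Proof.
move=> nR /finitely_generatedP [n [g gS]].
exact: noetherian_module_surj gS (noetherian_module_row nR).
Qed.

Fixpoint span_over V (U : set V) (s : seq V) : set V :=
  if s is u :: s' then [set v | exists a w, span_over U s' w /\ v = a *: u + w]
    else U.

Lemma span_over_submodule V (U : set V) s : submodule U ->
  submodule (span_over U s).
Proof.
move=> Usub; elim: s => //= u s IHs;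
  split=> [|a x y [b [w [sw ->]]] [c [w' [sw' ->]]]].
  by exists 0, 0; rewrite scale0r addr0; split=> //; apply: submod0.
exists (a * b + c), (a *: w + w'); split; first exact: IHs.2.
by rewrite scalerDr scalerDl scalerA addrACA.
Qed.

Lemma span_over_tail V (U : set V) u s : span_over U s `<=` span_over U
  (u :: s).
Proof. by move=> v sv; exists 0, v; rewrite scale0r add0r. Qed.

Lemma span_over_head V (U : set V) u s : submodule U -> span_over U (u :: s) u.
Proof.
move=> Usub; exists 1, 0; rewrite scale1r addr0; split=> //.
by apply: submod0; apply: span_over_submodule.
Qed.

(** A maximal element among the submodules spanned over [U] by finitely many
    elements of [P] cannot be enlarged by a further element of [P]. *)
Lemma span_over_exhausts V (U : set V) (P : set V) : noetherian_module V ->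
  submodule U ->
  exists2 s, {in s, forall v, P v} & P `<=` span_over U s.
Proof.
move=> nV Usub; pose C :=
  [set span_over U s | s in [set s | {in s, forall v, P v}]].
have [||_ [[s sP <-] smax]] := nV C.
- by move=> _ [s _ <-]; apply: span_over_submodule.
- by exists U, [::].
exists s => // w Pw; apply: (smax (span_over U (w :: s)));
  last exact: span_over_head.
  by exists (w :: s) => // v; rewrite in_cons => /predU1P[->|/sP].
exact: span_over_tail.
Qed.

Lemma submodule_fg V (U : set V) : noetherian_module V -> submodule U ->
  exists n (g : {linear 'rV[R]_n -> V}), forall v, U v <-> exists x, g x = v.
Proof.
move=> nV Usub; have sub0 : submodule [set (0 : V)].
  by split=> // a u v -> ->; rewrite scaler0 addr0.
have [s sU Us] := span_over_exhausts U nV sub0.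
have [g gE] := row_map (fun j : 'I_(size s) => s`_j); exists (size s), g => v.
split=> [/Us|[x <-]]; last first.
  by rewrite gE; apply: submod_sum => // j _; apply: submodZ => //; apply: sU;
    apply: mem_nth.
move=> sv; suff [c ->] : exists c : nat -> R, v = \sum_(j < size s) c j *: s`_j.
  by exists (\row_j c j); rewrite gE; apply: eq_bigr => j _; rewrite mxE.
elim: (s) v sv => [v ->|u s' IHs v [a [w [/IHs [c ->] ->]]]] /=.
  by exists (fun=> 0); rewrite big_ord0.
by exists (fun k => if k is k'.+1 then c k' else a); rewrite big_ord_recl.
Qed.

End Noetherian.

(** * Regular sequences and their exchange *)

Section RegularSequences.
Variables (R : comNzRingType) (m : set R^o).
Implicit Types (V W : lmodType R) (a b r z : R) (s x y : seq R).

(** Quotients V/U are replaced by the submodule [U] throughout: [a] acts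
    injectively on V/U. *)
Definition regular_mod V a (U : set V) := forall v, U (a *: v) -> U v.

(** The submodule U + aV. *)
Definition add_mult V (U : set V) a : set V :=
  [set v | exists2 u, U u & exists w, v = u + a *: w].

Definition add_mults V (U : set V) s := foldl (@add_mult V) U s.

(** Unlike [regular_sequence], this leaves out the condition that V/(U + sV) is
    nonzero; it is then inherited by syzygies and by all free modules of finite
    rank, zero included. *)
Fixpoint weakly_regular V (U : set V) s : Prop :=
  if s is a :: s' then regular_mod a U /\ weakly_regular (add_mult U a) s'
  else True.

Definition socle_free V (U : set V) :=
  forall v, (forall r, m r -> U (r *: v)) -> U v.

Lemma add_mult_submodule V (U : set V) a : submodule U ->
  submodule (add_mult U a).
Proof.
move=> subU; split=> [|c _ _ [u Uu [w ->]] [u' Uu' [w' ->]]].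
  by exists 0; [apply: submod0|exists 0; rewrite scaler0 addr0].
exists (c *: u + u'); first exact: subU.2.
by exists (c *: w + w'); rewrite !scalerDr !scalerA [a * c]mulrC addrACA.
Qed.

Lemma add_mult_incl V (U : set V) a : U `<=` add_mult U a.
Proof. by move=> u Uu; exists u => //; exists 0; rewrite scaler0 addr0. Qed.

Lemma add_mult_mul V (U : set V) a w : submodule U -> add_mult U a (a *: w).
Proof. by move=> subU; exists 0; [apply: submod0|exists w; rewrite add0r]. Qed.

Lemma add_multC V (U : set V) a b :
  add_mult (add_mult U a) b = add_mult (add_mult U b) a.
Proof.
wlog suff incl : a b / add_mult (add_mult U a) b `<=` add_mult (add_mult U b) a.
  by apply/seteqP; split; apply: incl.
move=> _ [_ [u Uu [w ->]] [w' ->]]; exists (u + b *: w');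
  first by exists u => //; exists w'.
by exists w; rewrite addrAC.
Qed.

Lemma add_mults_submodule V (U : set V) s : submodule U ->
  submodule (add_mults U s).
Proof. by rewrite /add_mults; elim: s U => [|a s IHs] U subU //=; apply: IHs;
  apply: add_mult_submodule. Qed.

Lemma add_mults_incl V (U : set V) s : U `<=` add_mults U s.
Proof.
by rewrite /add_mults; elim: s U => [|a s IHs] U u Uu //=; apply: IHs;
  apply: add_mult_incl.
Qed.

Lemma add_mults_rcons V (U : set V) s a :
  add_mults U (rcons s a) = add_mult (add_mults U s) a.
Proof. by rewrite /add_mults foldl_rcons. Qed.

Lemma add_mults_add_mult V (U : set V) s a :
  add_mults (add_mult U a) s = add_mult (add_mults U s) a.
Proof. by rewrite /add_mults; elim: s U => [|b s IHs] U //=;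
  rewrite add_multC IHs. Qed.

Lemma weakly_regular_rcons V (U : set V) s a :
  weakly_regular U (rcons s a) <->
    weakly_regular U s /\ regular_mod a (add_mults U s).
Proof. by elim: s U => /= [|b s IHs] U; [|rewrite IHs]; tauto. Qed.

Lemma weakly_regular_nth V (U : set V) s k :
  weakly_regular U s -> (k < size s)%N ->
  regular_mod s`_k (add_mults U (take k s)).
Proof.
elim: s U k => [|a s IHs] U [|k] //= [aU sU] ks; first exact: aU.
exact: IHs.
Qed.

Lemma weakly_regular_take V (U : set V) s k : weakly_regular U s ->
  weakly_regular U (take k s).
Proof. by elim: s U k => [|a s IHs] U [|k] //= [aU /IHs]. Qed.

(** If av = u + bw, then bw vanishes modulo (U, a), hence w = u' + aw' with u'
    in [U], and v - bw' is killed by a modulo [U]. *)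
Lemma regular_mod_swap V (U : set V) a b : submodule U ->
  regular_mod a U -> regular_mod b (add_mult U a) ->
  regular_mod a (add_mult U b).
Proof.
move=> subU aU bUa v [u Uu [w avE]].
have [u' Uu' [w' wE]] : add_mult U a w.
  apply: bUa; have -> : b *: w = - u + a *: v by rewrite avE addKr.
  by apply: submodD; [apply: add_mult_submodule|apply: add_mult_incl;
    apply: submodN|apply: add_mult_mul].
exists (v - b *: w'); last by exists w'; rewrite subrK.
apply: aU; have -> : a *: (v - b *: w') = u + b *: u'.
  rewrite scalerBr avE wE scalerDr -addrA; congr (_ + _).
  by rewrite -addrA !scalerA [a * b]mulrC subrr addr0.
by apply: submodD => //; apply: submodZ.
Qed.

Lemma weakly_regular_add_mult V (U : set V) s z : submodule U ->
  weakly_regular U s ->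
  (forall k, (k <= size s)%N -> regular_mod z (add_mults U (take k s))) ->
  weakly_regular (add_mult U z) s.
Proof.
elim: s U => [|a s IHs] U //= subU [aU sUa] zUs; split.
  by apply: regular_mod_swap => //; have := zUs 1%N isT; rewrite /= take0.
rewrite add_multC; apply: IHs => // [|k ks]; first exact: add_mult_submodule.
exact: (zUs k.+1).
Qed.

(** If bv = aw modulo [U], the class of v modulo (U, a) determines that of w
    modulo (U, b) and conversely; this identifies the socles of V/(U + aV) and
    V/(U + bV). *)
Lemma socle_free_exchange V (U : set V) a b : submodule U -> m b ->
  regular_mod a U -> regular_mod b U -> socle_free (add_mult U b) ->
  socle_free (add_mult U a).
Proof.
move=> subU mb aU bU soc v mv; have [u Uu [w bvE]] := mv b mb.
have [r mr|u' Uu' [w' wE]] := soc w.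
  have [u' Uu' [t rvE]] := mv r mr.
  exists (r *: w - b *: t); last by exists t; rewrite subrK.
  apply: aU; have -> : a *: (r *: w - b *: t) = b *: u' - r *: u.
    have -> : b *: u' = b *: (r *: v) - b *: (a *: t)
      by rewrite rvE scalerDr addrK.
    have -> : b *: (r *: v) = r *: u + (a * r) *: w.
      rewrite scalerA [b * r]mulrC -[in LHS]scalerA bvE scalerDr.
      by rewrite scalerA [r * a]mulrC.
    by rewrite scalerBr !scalerA [a * b]mulrC addrAC [r *: u + _]addrC addrK.
  by apply: submodB => //; apply: submodZ.
exists (v - a *: w'); last by exists w'; rewrite subrK.
apply: bU; have -> : b *: (v - a *: w') = u + a *: u'.
  rewrite scalerBr bvE wE scalerDr -addrA; congr (_ + _).
  by rewrite -addrA !scalerA [b * a]mulrC subrr addr0.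
by apply: submodD => //; apply: submodZ.
Qed.

Lemma regular_mod_socle_free V (U : set V) a : m a -> regular_mod a U ->
  socle_free U.
Proof. by move=> ma aU v mv; apply: aU; apply: mv. Qed.

Definition prime_set (P : set R^o) :=
  submodule P /\ forall a b, P (a * b) -> P a \/ P b.

Definition ann V (U : set V) (v : V) : set R^o := [set r | U ((r : R) *: v)].

Lemma ann_submodule V (U : set V) v : submodule U -> submodule (ann U v).
Proof.
move=> subU; split=> [|a r r' Ur Ur']; first by rewrite /ann /= scale0r;
  apply: submod0.
by rewrite /ann /= scalerDl -scalerA; apply: subU.2.
Qed.

(** These elements have prime annihilators, which suffice to detect all zero
    divisors on V/U. *)
Definition max_ann V (U : set V) (v : V) :=
  ~ U v /\ forall w, ~ U w -> ann U v `<=` ann U w -> ann U w `<=` ann U v.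

(** If ab kills v and bv is nonzero, then the annihilator of bv contains that
    of v, so by maximality they agree, and it contains a. *)
Lemma max_ann_prime V (U : set V) v : submodule U -> max_ann U v ->
  prime_set (ann U v).
Proof.
move=> subU [nUv vmax]; split=> [|a b Uabv]; first exact: ann_submodule.
have [Ubv|nUbv] := pselect (U (b *: v)); [by right|left].
apply: (vmax (b *: v)) => // [r Urv|]; last by rewrite /ann /= scalerA.
by rewrite /ann /= scalerA mulrC -scalerA; apply: submodZ.
Qed.

Lemma max_ann_exists V (U : set V) v :
  noetherian_module R^o -> submodule U -> ~ U v ->
  exists2 w, max_ann U w & ann U v `<=` ann U w.
Proof.
move=> nR subU nUv.
pose C := [set ann U w | w in [set w | ~ U w /\ ann U v `<=` ann U w]].
have [||_ [[w [nUw vw] <-] wmax]] := nR C.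
- by move=> _ [w _ <-]; apply: ann_submodule.
- by exists (ann U v), v => //; split.
exists w => //; split=> // w' nUw' ww'; apply: wmax => //.
by exists w' => //; split=> //; apply: subset_trans ww'.
Qed.

(** Pick finitely many elements [vs] with maximal annihilator that span all the
    others over [U]. A combination w of [vs] is killed by the product of the
    annihilators of [vs], so a prime annihilator of w contains one of them. *)
Lemma max_ann_finite V (U : set V) : noetherian_module V -> submodule U ->
  exists2 vs : seq V, {in vs, forall v, max_ann U v} &
    forall w, max_ann U w -> exists2 v, v \in vs & ann U w `<=` ann U v.
Proof.
move=> nV subU; have [vs vsmax vsP] := span_over_exhausts (max_ann U) nV subU.
exists vs => // w wmax; apply: contrapT => now.
have [r nUrw rvs] : exists2 r, ~ U (r *: w) & {in vs, forall v, U (r *: v)}.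
  have : {in vs, forall v, exists2 r, U (r *: v) & ~ U (r *: w)}.
    move=> v vvs; apply: contrapT => nor; apply: now; exists v => //.
    apply: (vsmax v vvs).2; first exact: wmax.1.
    by move=> r Urv; apply: contrapT => nUrw; apply: nor; exists r.
  elim: (vs) => [_|v s IHs sP].
    by exists 1 => //; rewrite scale1r; apply: wmax.1.
  have [v' v's|r nUrw rs] := IHs; first by apply: sP; rewrite in_cons v's orbT.
  have [r' Ur'v nUr'w] := sP v (mem_head _ _).
  exists (r * r'); first by move/((max_ann_prime subU wmax).2) => [].
  move=> v'; rewrite in_cons => /predU1P[->|/rs Urv'].
    by rewrite -scalerA; apply: submodZ.
  by rewrite mulrC -scalerA; apply: submodZ.
apply: nUrw; have := vsP w wmax.
elim: (vs) (rvs) w {wmax now vsP} => [_ w Uw|v s IHs rs w [a [w' [sw' ->]]]].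
  exact: submodZ.
rewrite scalerDr; apply: submodD => //.
  by rewrite scalerA mulrC -scalerA; apply: submodZ => //; apply: rs;
    rewrite mem_head.
by apply: IHs => // v' v's; apply: rs; rewrite in_cons v's orbT.
Qed.

(** The finitely many maximal annihilators cover all zero divisors; none of
    them contains [m], as that would produce a socle element. *)
Lemma zero_divisor_primes V (Us : seq (set V)) :
    noetherian_module R^o -> noetherian_module V ->
    {in Us, forall U, submodule U /\ socle_free U} ->
  exists2 Ps : seq (set R^o),
    {in Ps, forall P, prime_set P /\ ~ (m `<=` P)} &
    forall z, {in Ps, forall P, ~ P z} -> {in Us, forall U, regular_mod z U}.
Proof.
move=> nR nV; elim: Us => [_|U Us IHUs UsP]; first by exists [::].
have [U' U'Us|Ps PsP Psz] := IHUs; first by apply: UsP;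
  rewrite in_cons U'Us orbT.
have [subU socU] := UsP U (mem_head _ _).
have [vs vsmax vsP] := max_ann_finite nV subU.
exists ([seq ann U v | v <- vs] ++ Ps) => [P|z zP U'].
  rewrite mem_cat => /orP[/mapP[v vvs ->]|/PsP //].
  split; first by apply: max_ann_prime => //; apply: vsmax.
  by move=> mv; apply: (vsmax v vvs).1; apply: socU => r /mv.
rewrite in_cons => /predU1P[->|]; last first.
  by apply: Psz => P PPs; apply: zP; rewrite mem_cat PPs orbT.
move=> v Uzv; apply: contrapT => nUv.
have [w wmax vw] := max_ann_exists nR subU nUv.
have [v' v'vs wv'] := vsP w wmax.
apply: (zP (ann U v')); last by apply: wv'; apply: vw.
by rewrite mem_cat; apply/orP; left; apply: map_f.
Qed.

(** Induction on the number of primes. If a prime Q of the list lies in [P],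
    then Q can be dropped. Otherwise, when the element z avoiding the rest lies
    in P, it is corrected by an element of m and of all the other primes
    outside P. *)
Lemma prime_avoidance (Ps : seq (set R^o)) : submodule m ->
  {in Ps, forall P, prime_set P /\ ~ (m `<=` P)} ->
  exists2 z, m z & {in Ps, forall P, ~ P z}.
Proof.
move=> subm; move: {2}(size Ps) (erefl (size Ps)) => n.
elim: n Ps => [|n IHn] [|P Ps] //= => [_ _|[sPs] PsP].
  by exists 0 => //; apply: submod0.
have [[Q QPs QP]|noQ] := pselect (exists2 Q, Q \in Ps & Q `<=` P).
  have [||z mz zP] := IHn (P :: rem Q Ps).
  - by rewrite /= size_rem // sPs; case: (n) sPs QPs => //; case: Ps {PsP}.
  - by move=> P'; rewrite in_cons => /predU1P[->|/mem_rem P'Ps];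
      apply: PsP; rewrite in_cons ?eqxx ?P'Ps ?orbT.
  exists z => // P'; have nPz : ~ P z by apply: zP; rewrite mem_head.
  rewrite in_cons => /predU1P[->//|P'Ps].
  have [->|P'Q] := eqVneq P' Q; first by move/QP.
  by apply: zP; rewrite in_cons; apply/orP; right; apply: rem_mem.
have [Q QPs|z mz zP] := IHn Ps sPs; first by apply: PsP;
  rewrite in_cons QPs orbT.
have [nPz|] := pselect (~ P z).
  by exists z => // Q; rewrite in_cons => /predU1P[->//|/zP].
move=> /contrapT Pz.
have [[subP primeP] nmP] := PsP P (mem_head _ _).
(* an element of m and of all primes of Ps, but not of P *)
have [c [mc nPc cPs]] :
    exists c : R^o, [/\ m c, ~ P c & {in Ps, forall Q, Q c}].
  have : {in Ps, forall Q, submodule Q /\ ~ (Q `<=` P)}.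
    move=> Q QPs; split; last by move=> QP; apply: noQ; exists Q.
    by have [|[]] := PsP Q; rewrite ?in_cons ?QPs ?orbT.
  elim: (Ps) => [_|Q s IHs sP].
    have [c [mc nPc]] : exists c : R^o, m c /\ ~ P c.
      apply: contrapT => noc; apply: nmP => c mc; apply: contrapT => nPc.
      by apply: noc; exists c.
    by exists c; split.
  have [Q' Q's|c [mc nPc cs]] := IHs; first by apply: sP;
    rewrite in_cons Q's orbT.
  have [subQ nQP] := sP Q (mem_head _ _).
  have [t [Qt nPt]] : exists t, Q t /\ ~ P t.
    apply: contrapT => not; apply: nQP => t Qt; apply: contrapT => nPt.
    by apply: not; exists t.
  exists (t * c); split; first exact: (submodZ subm t mc).
    by move=> /primeP[].
  move=> Q'; rewrite in_cons => /predU1P[->|Q's].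
    by rewrite mulrC; exact: (submodZ subQ c Qt).
  apply: (@submodZ R R^o Q' _ t c); last exact: cs.
  by have [] := sP Q'; rewrite // in_cons Q's orbT.
exists (z + c); first exact: submodD.
move=> Q; rewrite in_cons => /predU1P[->|QPs] Pzc.
  by apply: nPc; apply: (submodDr subP Pz); rewrite addrC.
apply: (zP Q QPs); apply: (submodDr _ (cPs Q QPs) Pzc).
by have [|[]] := PsP Q; rewrite ?in_cons ?QPs ?orbT.
Qed.

Lemma common_nonzerodivisor V W (Us : seq (set V)) (Ws : seq (set W)) :
  submodule m -> noetherian_module R^o -> noetherian_module V ->
    noetherian_module W ->
  {in Us, forall U, submodule U /\ socle_free U} ->
  {in Ws, forall U, submodule U /\ socle_free U} ->
  exists z, [/\ m z, {in Us, forall U, regular_mod z U} &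
    {in Ws, forall U, regular_mod z U}].
Proof.
move=> subm nR nV nW UsP WsP.
have [Ps PsP PsU] := zero_divisor_primes nR nV UsP.
have [Qs QsP QsW] := zero_divisor_primes nR nW WsP.
have [|z mz zP] := @prime_avoidance (Ps ++ Qs) subm.
  by move=> P; rewrite mem_cat => /orP[/PsP|/QsP].
exists z; split=> //; [apply: PsU|apply: QsW] => P PP; apply: zP;
  by rewrite mem_cat PP ?orbT.
Qed.

(** A regular sequence shorter than another one is not maximal. For the
    induction, choose z regular modulo all proper initial segments of [x] and
    [y]. The exchange of the last term of [x] for z preserves the vanishing of
    the socle, and z can be moved to the front of both sequences, which become
    regular sequences modulo z with one term less. *)
Lemma regular_exchange V i (U : set V) x y :
    submodule m -> noetherian_module R^o -> noetherian_module V ->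
      submodule U ->
    {in x, forall a, m a} -> {in y, forall a, m a} ->
    size x = i -> size y = i.+1 -> weakly_regular U x -> weakly_regular U y ->
  socle_free (add_mults U x).
Proof.
move=> subm nR nV; elim: i U x y => [|i IHi] U.
  move=> [|//] [|b [|//]] //= _ _ yP _ _ _ [bU _].
  by apply: regular_mod_socle_free bU; apply: yP; rewrite mem_head.
case/lastP=> // x a; case/lastP=> // y b; rewrite !size_rcons.
move=> subU xP yP [sx] [sy] xU yU.
have [z [mz zP _]] : exists z, [/\ m z,
    {in [seq add_mults U (take k x) | k <- iota 0 i.+1] ++
        [seq add_mults U (take k y) | k <- iota 0 i.+2], forall U,
          regular_mod z U} &
    {in [::], forall U : set V, regular_mod z U}].
  apply: common_nonzerodivisor => // W.
  have tk (s : seq R) c k : {in rcons s c, forall a, m a} ->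
    weakly_regular U (rcons s c) ->
      (k <= size s)%N -> submodule (add_mults U (take k s)) /\ socle_free
        (add_mults U (take k s)).
    move=> sP sU ks; split; first exact: add_mults_submodule.
    have {}ks : (k < size (rcons s c))%N by rewrite size_rcons.
    apply: (@regular_mod_socle_free _ _ (rcons s c)`_k);
      first by apply/sP/mem_nth.
    have := weakly_regular_nth sU ks; rewrite -cats1 takel_cat //.
    by move: ks; rewrite size_rcons.
  by rewrite mem_cat => /orP[] /mapP[k];
    rewrite mem_iota add0n ltnS => /andP[_ ks] ->;
    [apply: (tk x a)|apply: (tk y b)]; rewrite ?sx ?sy.
have [xU' aUx] := (weakly_regular_rcons _ _ _).1 xU;
  have [yU' _] := (weakly_regular_rcons _ _ _).1 yU.
rewrite add_mults_rcons; apply: (@socle_free_exchange _ _ a z) => //;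
  first exact: add_mults_submodule.
  apply: zP; rewrite mem_cat; apply/orP; left; apply/mapP; exists i.
    by rewrite mem_iota add0n ltnS leqnn.
  by rewrite take_oversize // sx.
rewrite -add_mults_add_mult; apply: (IHi (add_mult U z) x y) => //.
- exact: add_mult_submodule.
- by move=> c cx; apply: xP; rewrite mem_rcons in_cons cx orbT.
- by move=> c cx; apply: yP; rewrite mem_rcons in_cons cx orbT.
- apply: weakly_regular_add_mult => // k; rewrite sx => ks; apply: zP;
  rewrite mem_cat; apply/orP; left.
  by apply/mapP; exists k; rewrite // mem_iota add0n ltnS.
- apply: weakly_regular_add_mult => // k; rewrite sy => ks; apply: zP;
  rewrite mem_cat; apply/orP; right.
  by apply/mapP; exists k; rewrite // mem_iota add0n ltnS.
Qed.

End RegularSequences.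

(** * Minimal generators and depth over a local ring *)

Section LocalRings.
Variables (R : comNzRingType) (m : {pred R}).
Hypothesis R_local : local_ring m.
Let mS : set R^o := [set r : R^o | (r : R) \in m].

Lemma idealr_closed_submodule (I : {pred R}) : idealr_closed I ->
  submodule ([set r | (r : R) \in I] : set R^o).
Proof. by case=> I0 _ IP; split=> // a u v; apply: IP. Qed.

Lemma local_ideal_submodule : submodule mS.
Proof. exact: idealr_closed_submodule R_local.1.1. Qed.

Lemma local_ideal_proper : 1 \notin m.
Proof. by case: R_local.1.1. Qed.

Lemma proper_subset_local (U : set R^o) :
  noetherian_module R^o -> submodule U -> ~ U 1 ->
  U `<=` mS.
Proof.
move=> nR subU nU1; pose C := [set W | [/\ submodule W, ~ W 1 & U `<=` W]].
have [||W [[subW nW1 UW] Wmax]] := nR C; [by move=> W []|by exists U; split|].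
have idW : idealr_closed (submod_pred W : {pred R}).
  have [W0 WP] := submod_predP subW; split=> [//||a u v]; last exact: WP.
  by apply/negP => /asboolP.
suff Wm : (submod_pred W : {pred R}) =i m.
  by move=> u /UW Wu; rewrite /mS /= -Wm; apply/asboolP.
apply: R_local.2; split=> // J idJ WJ r; apply/idP/idP; last exact: WJ.
move=> rJ; apply/asboolP; apply: (Wmax [set r : R^o | (r : R) \in J]) => //.
  split; first exact: idealr_closed_submodule.
    by case: idJ => _ /negP.
  by move=> u /UW Wu; apply: WJ; apply/asboolP.
by move=> u Wu; apply: WJ; apply/asboolP.
Qed.

Lemma local_unit (a : R) : noetherian_module R^o -> a \notin m ->
  exists b, a * b = 1.
Proof.
move=> nR am; apply: contrapT => nab.
pose U : set R^o := [set r | exists b, r = a * b :> R].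
have subU : submodule U.
  split=> [|c _ _ [b ->] [b' ->]]; first by exists 0; rewrite mulr0.
  by exists (c * b + b'); rewrite mulrDr mulrCA.
have Um : U `<=` mS.
  by apply: proper_subset_local => // -[b /esym abE]; apply: nab; exists b.
by move/negP: am; apply; apply: (Um a); exists 1; rewrite mulr1.
Qed.

(** A relation with a coefficient outside [m], hence a unit, would express one
    generator by the others. *)
Lemma minimal_relation (V : lmodType R) n (v : 'I_n -> V) (c : 'I_n -> R) :
  noetherian_module R^o -> Defs.span v = setT ->
  (forall k, generated_by V k -> (n <= k)%N) ->
  \sum_j c j *: v j = 0 -> forall j, c j \in m.
Proof.
move=> nR; case: n v c => [|n] v c vT nmin rel j; first by case: j.
apply: contraPT (leqnn n.+1) => /local_unit [//|b cb]; apply/negP;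
  rewrite -ltnNge.
rewrite ltnS; apply: nmin; exists (fun k => v (lift j k)); apply/seteqP;
  split=> // x _.
have : Defs.span v x by rewrite vT.
move=> [d ->]; exists (fun k => d (lift j k) - d j * b * c (lift j k)).
have split_sum F : \sum_k F k = F j + \sum_k F (lift j k) :> V.
  by rewrite (bigD1_ord j).
have brel : b *: \sum_j c j *: v j = 0 by rewrite rel scaler0.
have vjE : v j = - \sum_k (b * c (lift j k)) *: v (lift j k).
  apply/eqP; rewrite -addr_eq0 -[v j]scale1r -cb mulrC; apply/eqP.
  rewrite -[RHS]brel split_sum scalerDr scalerA; congr (_ + _).
  by rewrite scaler_sumr; apply: eq_bigr => k _; rewrite scalerA.
rewrite split_sum vjE scalerN scaler_sumr addrC -sumrB; apply: eq_bigr => k _.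
by rewrite scalerBl !scalerA mulrA.
Qed.

Lemma min_generators (V : lmodType R) : finitely_generated V ->
  generated_by V (mu V) /\ forall k, generated_by V k -> (mu V <= k)%N.
Proof.
move=> [n0 Vn0].
have ex : exists n, `[< generated_by V n >] by exists n0; apply/asboolP.
have [n /asboolP Vn nmin] := ex_minnP ex.
suff -> : mu V = n by split=> // k Vk; apply: nmin; apply/asboolP.
have nP : infimums [set n | generated_by V n] n.
  split=> [k /= Vk|k]; last exact.
  by rewrite leEnat; apply: nmin; apply/asboolP.
rewrite /mu /infimum ifF; last by apply/negbTE/set0P; exists n.
by apply: (is_subset1_infimums _ nP); apply: xgetPex; exists n.
Qed.

(** The first coordinate with respect to minimal generators is well defined
    modulo [m]; this replaces a surjection from V onto the residue field. *)
Lemma residue_coordinate (V : lmodType R) :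
    noetherian_module R^o -> finitely_generated V -> ~ zero_module V ->
  exists phi : V -> R,
    (forall a v w, phi (a *: v + w) - (a * phi v + phi w) \in m) /\
    exists v, phi v \notin m.
Proof.
move=> nR Vfg Vn0; have [[v vT] vmin] := min_generators Vfg.
move: (mu V) v vT vmin => [|n] v vT vmin.
  case: Vn0 => x; have : Defs.span v x by rewrite vT.
  by move=> [c ->]; rewrite big_ord0.
have /boolp.choice [c cE] :
  forall x, exists c : 'I_n.+1 -> R, x = \sum_j c j *: v j.
  by move=> x; have : Defs.span v x by rewrite vT.
have rel := minimal_relation nR vT vmin.
exists (fun x => c x ord0); split=> [a x y|].
  apply: (rel (fun j => c (a *: x + y) j - (a * c x j + c y j))).
  rewrite (eq_bigr (fun j => c (a *: x + y) j *: v j -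
      (a *: (c x j *: v j) + c y j *: v j))); last first.
    by move=> j _; rewrite scalerBl scalerDl scalerA.
  by rewrite sumrB big_split /= -scaler_sumr -!cE subrr.
exists (v ord0); apply/negP => cm.
have dm : (ord0 == ord0 :> 'I_n.+1)%:R - c (v ord0) ord0 \in m.
  apply: (rel (fun j => (j == ord0)%:R - c (v ord0) j)).
  rewrite (eq_bigr (fun j => (j == ord0)%:R *: v j - c (v ord0) j *: v j));
    last first.
    by move=> j _; rewrite scalerBl.
  rewrite sumrB -cE big_ord_recl eqxx scale1r big1 ?addr0 ?subrr // => j _.
  by rewrite scale0r.
have := submodD local_ideal_submodule dm cm.
by rewrite eqxx subrK; apply/negP/local_ideal_proper.
Qed.

Lemma syzygy_coordinates (L : lmodType R)
    (p : {linear 'rV[R]_(mu L) -> L}) x j :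
  noetherian_module R^o -> finitely_generated L -> is_surjective p ->
  p x = 0 -> x 0 j \in m.
Proof.
move=> nR Lfg pS px; have [_ muL] := min_generators Lfg.
apply: (@minimal_relation L (mu L) (fun j => p (delta_mx 0 j))
  (fun j => x 0 j)) => //.
  apply/seteqP; split=> // y _; have [z <-] := pS y.
  by exists (fun j => z 0 j); rewrite -row_mapE.
by rewrite -row_mapE.
Qed.

Lemma seq_submoduleE (V : lmodType R) s :
  seq_submodule s = add_mults [set (0 : V)] s.
Proof.
elim/last_ind: s => [|s a IHs].
  by apply/seteqP; split=> v /=; [case=> c ->|move=> ->; exists (fun=> 0)];
    rewrite big_ord0.
rewrite add_mults_rcons -IHs; apply/seteqP; split=> v.
  move=> [c ->]; rewrite size_rcons big_ord_recr /= nth_rcons ltnn eqxx.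
  exists (\sum_(i < size s) s`_i *: c i); first by exists c.
  exists (c (size s)); congr (_ + _); apply: eq_bigr => i _.
  by rewrite nth_rcons ltn_ord.
move=> [_ [c ->] [w ->]]; exists (fun k => if (k < size s)%N then c k else w).
rewrite size_rcons big_ord_recr /= ltnn nth_rcons ltnn eqxx; congr (_ + _).
by apply: eq_bigr => i _; rewrite nth_rcons ltn_ord.
Qed.

Lemma regular_sequenceP (V : lmodType R) s : regular_sequence m V s <->
  [/\ {subset s <= m}, weakly_regular [set (0 : V)] s &
    exists v, ~ add_mults [set (0 : V)] s v].
Proof.
split=> -[sm sreg [v vs]]; split=> //;
  try by exists v; rewrite ?seq_submoduleE // -seq_submoduleE.
  have {}sreg k : (k < size s)%N ->
    regular_mod s`_k (add_mults [set (0 : V)] (take k s)).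
    by move=> /sreg; rewrite seq_submoduleE.
  elim/last_ind: s sreg {sm v vs} => [|s a IHs] sreg; first by [].
  apply/weakly_regular_rcons; split.
    apply: IHs => k ks; have := sreg k;
      rewrite size_rcons ltnS ltnW // => /(_ isT).
    by rewrite nth_rcons ks -cats1 takel_cat // ltnW.
  have := sreg (size s); rewrite size_rcons ltnSn nth_rcons ltnn eqxx.
  by rewrite -cats1 take_size_cat // => /(_ isT).
by move=> k ks; rewrite seq_submoduleE; apply: weakly_regular_nth.
Qed.

Lemma zero_submodule (V : lmodType R) : submodule [set (0 : V)].
Proof. by split=> // a u v -> ->; rewrite scaler0 addr0. Qed.

Lemma add_mults_local s : {subset s <= m} ->
  add_mults [set (0 : R^o)] s `<=` mS.
Proof.
move=> sm; rewrite -seq_submoduleE => _ [c ->].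
have subm := local_ideal_submodule; apply: submod_sum => // i _.
rewrite -[s`_i *: c i]/(s`_i * (c i : R)) mulrC.
apply: (@submodZ R R^o mS subm (c i) s`_i).
by apply: sm; apply: mem_nth.
Qed.

(** If all W-regular sequences had length at most [i], their maximal length
    would be attained and equal to the depth of [W], hence of [V], against the
    existence of [s]. *)
Lemma depth_bound (V W : lmodType R) (i : nat) s :
    depth m V = depth m W -> regular_sequence m V s -> (i < size s)%N ->
    regular_sequence m W [::] ->
  exists2 t, regular_sequence m W t & (i < size t)%N.
Proof.
move=> VW sV si W0; apply: contrapT => noW.
have Wi t : regular_sequence m W t -> (size t <= i)%N.
  by move=> tW; rewrite leqNgt; apply/negP => ti; apply: noW; exists t.
have ex : exists n, `[< exists2 t, regular_sequence m W t & size t = n >].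
  by exists 0%N; apply/asboolP; exists [::].
have [k|n /asboolP [t tW tn] nmax] := @ex_maxnP _ i ex.
  by move=> /asboolP [t /Wi ti <-].
have Wn : depth m W = (n%:Z)%:E%E.
  pose S : set (\bar int) :=
    [set ((size s)%:Z)%:E%E | s in regular_sequence m W].
  have nP : supremums S (n%:Z)%:E%E.
    split=> [_ [u uW <-]|x]; last by apply; exists t; rewrite ?tn.
    by rewrite lee_fin; apply: nmax; apply/asboolP; exists u.
  rewrite /depth /supremum ifF; last by apply/negbTE/set0P; exists (n%:Z)%:E%E;
    exists t; rewrite ?tn.
  by apply: (is_subset1_supremums _ nP); apply: xgetPex; exists (n%:Z)%:E%E.
move: VW; rewrite Wn /depth /supremum ifF; last first.
  by apply/negbTE/set0P; exists ((size s)%:Z)%:E%E; exists s.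
case: xgetP => [x -> [xub _] xn|_ //].
have := xub ((size s)%:Z)%:E%E; rewrite xn lee_fin => sn.
have {sn} : ((size s)%:Z <= n%:Z)%R by apply: sn; exists s.
rewrite lez_nat leqNgt => /negP; apply; apply: leq_ltn_trans si.
by rewrite -tn; apply: Wi.
Qed.

(** Take (x) maximal among the ideals generated by sequences that are regular
    on both R and L. If R/(x) and L/xL had zero socle, a common nonzerodivisor
    would extend x. If only the socle of R/(x) were zero, then R would have a
    regular sequence longer than x, hence so would L, and [regular_exchange]
    would make the socle of L/xL zero as well. *)
Lemma common_regular_sequence (L : lmodType R) :
    noetherian_module R^o -> finitely_generated L -> ~ zero_module L ->
    depth m R^o = depth m L ->
  exists x s, [/\ weakly_regular [set (0 : R^o)] x,
    weakly_regular [set (0 : L)] x, ~ add_mults [set (0 : R^o)] x s &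
    forall r, r \in m -> add_mults [set (0 : R^o)] x (r * s)].
Proof.
move=> nR Lfg Ln0 RL.
have nL := noetherian_module_fg nR Lfg; have subm := local_ideal_submodule.
have sub0R := zero_submodule R^o; have sub0L := zero_submodule L.
pose C := [set add_mults [set (0 : R^o)] x | x in
  [set x | [/\ {subset x <= m}, weakly_regular [set (0 : R^o)] x &
    weakly_regular [set (0 : L)] x]]].
have [||_ [[x [xm xR xL] <-] xmax]] := nR C.
- by move=> _ [x _ <-]; apply: add_mults_submodule.
- by exists [set (0 : R^o)], [::]; split.
have nx1 : ~ add_mults [set (0 : R^o)] x 1.
  by move/(add_mults_local xm); apply/negP/local_ideal_proper.
suff nsoc : ~ socle_free mS (add_mults [set (0 : R^o)] x).
  suff [s nxs sx] : exists2 s, ~ add_mults [set (0 : R^o)] x s &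
      forall r, mS r -> add_mults [set (0 : R^o)] x (r * s) by exists x, s.
  apply: contrapT => nos; apply: nsoc => s sx; apply: contrapT => nxs.
  by apply: nos; exists s.
move=> socR.
have nsocL : ~ socle_free mS (add_mults [set (0 : L)] x).
  move=> socL.
  have [|U|z [zm zR zL]] := @common_nonzerodivisor R mS R^o L
      [:: add_mults [set (0 : R^o)] x] [:: add_mults [set (0 : L)] x] subm nR nR
        nL.
  - by move=> U; rewrite inE => /eqP ->; split=> //; apply: add_mults_submodule.
  - by rewrite inE => /eqP ->; split=> //; apply: add_mults_submodule.
  have {}zR := zR _ (mem_head _ _); have {}zL := zL _ (mem_head _ _).
  apply: nx1; apply: (zR);
    apply: (xmax (add_mults [set (0 : R^o)] (rcons x z))).
  - exists (rcons x z) => //; split; try by apply/weakly_regular_rcons; split.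
    by move=> c; rewrite mem_rcons in_cons => /predU1P[->|/xm].
  - by rewrite add_mults_rcons; apply: add_mult_incl.
  - by rewrite add_mults_rcons; apply: add_mult_mul; apply: add_mults_submodule.
apply: nsocL.
have [|//|z [zm zR _]] := @common_nonzerodivisor R mS R^o L
    [:: add_mults [set (0 : R^o)] x] [::] subm nR nR nL.
  by move=> U; rewrite inE => /eqP ->; split=> //; apply: add_mults_submodule.
have {}zR := zR _ (mem_head _ _).
have xzm : {subset rcons x z <= m}.
  by move=> c; rewrite mem_rcons in_cons => /predU1P[->|/xm].
have [|||y /regular_sequenceP[ym yL _] xy] := @depth_bound R^o L (size x)
  (rcons x z) RL.
- apply/regular_sequenceP; split=> //; first by apply/weakly_regular_rcons;
  split.
  by exists 1 => /(add_mults_local xzm); apply/negP/local_ideal_proper.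
- by rewrite size_rcons.
- apply/regular_sequenceP; split=> //; apply: contrapT => nov; apply: Ln0 => v.
  by apply: contrapT => vn0; apply: nov; exists v.
apply: (@regular_exchange R mS L (size x) _ x (take (size x).+1 y)) => //.
- by move=> c /mem_take /ym.
- by rewrite size_takel.
- exact: weakly_regular_take.
Qed.

End LocalRings.

(** * Divisible groups and relatively injective modules *)

Section Divisible.

Definition divisible (D : zmodType) :=
  forall (d : D) n, (0 < n)%N -> exists c, c *+ n = d.

Lemma rat_mod_int : exists D : zmodType,
  divisible D /\ forall n, (1 < n)%N -> exists2 c : D, c != 0 & c *+ n = 0.
Proof.
pose Z : set (zmodule rat) := [set q | exists k : int, q = k%:~R :> rat].
have subZ : submodule Z.
  split=> [|a _ _ [k ->] [l ->]]; first by exists 0.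
  by exists (a * k + l); rewrite intrD intrM mulrzl.
have [W [p [pS pZ]]] := quotient_exists subZ.
have pM (q : rat) n : p (q *+ n) = p q *+ n by exact: raddfMn.
exists W; split=> [d n n0|n n1].
  have [q <-] := pS d; exists (p ((q : rat) / n%:R)); rewrite -pM.
  suff -> : (q : rat) / n%:R *+ n = q by [].
  by rewrite -[_ *+ n]mulr_natr divfK // pnatr_eq0 -lt0n.
have n0 : n%:R != 0 :> rat by rewrite pnatr_eq0 -lt0n ltnW.
exists (p (n%:R^-1 : rat)); last first.
  by rewrite -pM -[_ *+ n]mulr_natr mulVf //; apply/pZ; exists 1.
apply/eqP => /pZ [k]; move/(congr1 (fun q : rat => q * n%:R));
  rewrite mulVf // => kn.
have {}kn : 1 = k * n%:R :> int.
  by apply: (@intr_inj rat); rewrite rmorphM /= rmorph_nat -kn.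
have := congr1 absz kn; rewrite abszM natz !absz_nat => /esym/eqP;
  rewrite muln_eq1 => /andP[_ /eqP n_1].
by rewrite n_1 in n1.
Qed.

Variables (F D : zmodType).
Implicit Types (G : set (F * D)) (f b : F) (d c : D).

(** The graph of a homomorphism from a subgroup of [F] to [D]: the last
    condition makes it single-valued. *)
Definition partial_hom G : Prop :=
  [/\ G (0, 0), forall u v, G u -> G v -> G (u.1 - v.1, u.2 - v.2)
    & forall d, G (0, d) -> d = 0].

Definition extend_graph G b d : set (F * D) :=
  [set u | exists2 v, G v & exists n : int, u = (v.1 + b *~ n, v.2 + d *~ n)].

Lemma partial_homN G u : partial_hom G -> G u -> G (- u.1, - u.2).
Proof. by move=> [G0 GB _] Gu; rewrite -[- u.1]add0r -[- u.2]add0r;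
  apply: (GB (0, 0)). Qed.

Lemma partial_homD G u v : partial_hom G -> G u -> G v ->
  G (u.1 + v.1, u.2 + v.2).
Proof.
move=> GP Gu /(partial_homN GP) GNv; have [_ GB _] := GP.
by have := GB _ _ Gu GNv; rewrite /= !opprK.
Qed.

Lemma partial_homMz G u n : partial_hom G -> G u -> G (u.1 *~ n, u.2 *~ n).
Proof.
move=> GP Gu; have nat_case k : G (u.1 *+ k, u.2 *+ k).
  elim: k => [|k IHk]; first by case: GP.
  by rewrite !mulrS; apply: (partial_homD GP Gu IHk).
case: n => k; first exact: nat_case.
by rewrite NegzE !mulrNz; apply: (partial_homN GP (nat_case k.+1)).
Qed.

Lemma partial_hom_fun G f d c : partial_hom G -> G (f, d) -> G (f, c) -> d = c.
Proof.
move=> [_ GB G0] Gd Gc; apply/subr0_eq/G0.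
by have := GB _ _ Gd Gc; rewrite /= subrr.
Qed.

Lemma extend_partial_hom G b d : partial_hom G ->
  (forall n c, G (b *~ n, c) -> c = d *~ n) -> partial_hom (extend_graph G b d).
Proof.
move=> GP Gb; have [G0 GB _] := GP; split.
- by exists (0, 0) => //; exists 0; rewrite /= !mulr0z !addr0.
- move=> _ _ [u Gu [n ->]] [v Gv [k ->]] /=.
  exists (u.1 - v.1, u.2 - v.2); first exact: (GB _ _ Gu Gv).
  by exists (n - k); rewrite /= !mulrzBr !opprD ![_ + _ *~ n + _]addrACA.
move=> c [[f e] Gfe [n []]] /= fb ->.
have fE : f = b *~ (- n) by rewrite mulrNz; apply/eqP; rewrite -addr_eq0 -fb.
by have := Gb (- n) e; rewrite -fE => /(_ Gfe) ->; rewrite mulrNz addNr.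
Qed.

Lemma extend_graph_sub G b d : G `<=` extend_graph G b d.
Proof. by move=> [f e] Gfe; exists (f, e) => //; exists 0;
  rewrite /= !mulr0z !addr0. Qed.

Lemma extend_graph_new G b d : partial_hom G -> extend_graph G b d (b, d).
Proof. by case=> G0 _ _; exists (0, 0) => //; exists 1;
  rewrite /= !mulr1z !add0r. Qed.

(** The value N = 0 encodes infinite order. *)
Lemma relative_order (A : zmodType) (S : A -> Prop) (b : A) :
  S 0 -> (forall u v, S u -> S v -> S (u - v)) ->
  exists N : nat, S (b *+ N) /\ forall n : int, S (b *~ n) ->
    exists q, n = q * N%:Z.
Proof.
move=> S0 SB; have SN u : S u -> S (- u) by rewrite -sub0r; apply: SB.
have SD u v : S u -> S v -> S (u + v) by move=> Su /SN Sv; rewrite -[v]opprK;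
  apply: SB.
have SM u n : S u -> S (u *~ n).
  move=> Su; have Sk k : S (u *+ k) by elim: k => // k Sk; rewrite mulrS;
    apply: SD.
  by case: n => k; [apply: Sk|rewrite NegzE mulrNz; apply/SN/Sk].
have [ex|noex] := pselect (exists n, `[< (0 < n)%N /\ S (b *+ n) >]);
  last first.
  exists 0%N; split=> // n Sn; exists 0; rewrite mul0r.
  apply: contrapT => n0; apply: noex; exists `|n|%N; apply/asboolP.
  split; first by rewrite absz_gt0; apply/eqP.
  case: n Sn {n0} => k; first by [].
  by rewrite NegzE mulrNz => /SN; rewrite opprK.
have [N /asboolP [N0 SbN] Nmin] := ex_minnP ex.
exists N; split=> // n Sn; exists (n %/ N%:Z)%Z.
rewrite {1}(divz_eq n N%:Z).
have r0 : 0 <= (n %% N%:Z)%Z by rewrite modz_ge0 // eqz_nat -lt0n.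
have rN : (n %% N%:Z)%Z < N%:Z by rewrite ltz_pmod.
have Sr : S (b *~ (n %% N%:Z)%Z).
  have -> : (n %% N%:Z)%Z = n - (n %/ N%:Z)%Z * N%:Z by rewrite
    {2}(divz_eq n N%:Z) addrC addKr.
  by rewrite mulrzBr [_ * N%:Z]mulrC mulrzA; apply: SB => //; apply: SM.
case: (n %% N%:Z)%Z r0 rN Sr => // r _; rewrite ltz_nat => rN Sr.
case: r rN Sr => [|r] rN Sr; first by rewrite addr0.
by have := Nmin r.+1 (introT (asboolP _) (conj isT Sr)); rewrite leqNgt rN.
Qed.

(** Take a maximal extension H. If f has order N modulo the domain of H and H
    maps Nf to d, then divisibility provides c with Nc = d, and f can be sent
    to c. *)
Lemma divisible_extension G : divisible D -> partial_hom G ->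
  exists chi : F -> D, (forall f g, chi (f - g) = chi f - chi g) /\
    forall u, G u -> chi u.1 = u.2.
Proof.
move=> divD GP; have [C CP [X0 CX0] totC|H [HP GH Hmax]] :=
  @Zorn_above _ partial_hom G GP.
  split.
  - by exists X0 => //; case: (CP X0 CX0).
  - move=> u v [X CX Xu] [Y CY Yv]; have [XY|YX] := totC X Y CX CY.
      by exists Y => //; case: (CP Y CY) => _ YB _; apply: YB => //; apply: XY.
    by exists X => //; case: (CP X CX) => _ XB _; apply: XB => //; apply: YX.
  - by move=> d [X CX Xd]; case: (CP X CX) => _ _; apply.
have Htot f : exists d, H (f, d).
  have [H0 HB _] := HP.
  have [||N [[d HNd] NP]] := @relative_order F (fun f => exists d, H (f, d)) f.
  - by exists 0.
  - by move=> u v [d Hu] [c Hv]; exists (d - c); apply: (HB _ _ Hu Hv).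
  have [c cP] : exists c : D, c *+ N = d.
    case: N d HNd {NP} => [|N] d HNd; last exact: divD.
    by exists 0; rewrite mulr0n (partial_hom_fun HP HNd H0).
  have ext : partial_hom (extend_graph H f c).
    apply: extend_partial_hom => // n e Hne;
      have [q nE] := NP n (ex_intro _ e Hne).
    apply: (partial_hom_fun HP Hne);
      rewrite nE [q * _]mulrC !mulrzA -!pmulrn cP.
    exact: (partial_homMz q HP HNd).
  exists c; apply: (Hmax _ ext); first exact: extend_graph_sub.
  exact: extend_graph_new.
have [chi chiP] := boolp.choice Htot; have [_ HB _] := HP.
exists chi; split=> [f g|[f d] /GH Hfd].
  by apply: (partial_hom_fun HP (chiP _)); apply: (HB _ _ (chiP f) (chiP g)).
exact: (partial_hom_fun HP (chiP _)).
Qed.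

End Divisible.

(** Send [s] to an element of [D] whose order divides the order of [s] modulo
    [S]; such a nonzero element exists because [s] lies outside [S], so that
    its order is not 1. *)
Lemma separating_character (A D : zmodType) (S : A -> Prop) (s : A) :
    divisible D ->
    (forall n, (1 < n)%N -> exists2 c : D, c != 0 & c *+ n = 0) ->
    S 0 -> (forall u v, S u -> S v -> S (u - v)) -> ~ S s ->
  exists chi : A -> D, [/\ forall f g, chi (f - g) = chi f - chi g,
    forall a, S a -> chi a = 0 & chi s != 0].
Proof.
move=> divD torD S0 SB nSs.
pose G : set (A * D) := [set u | S u.1 /\ u.2 = 0].
have GP : partial_hom G.
  split=> [|u v [Su u2] [Sv v2]|d [_ d2]] //.
  by split; [apply: SB|rewrite /= u2 v2 subrr].
have [N [SN NP]] := relative_order s S0 SB.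
have [c c0 cN] : exists2 c : D, c != 0 & forall q, c *~ (q * N%:Z) = 0.
  case: N SN NP => [|[|N]] SN NP; last 1 first.
  - have [c c0 cN] := torD N.+2 isT; exists c => // q.
    by rewrite mulrC mulrzA -pmulrn cN mul0rz.
  - by have [c c0 _] := torD 2%N isT; exists c => // q; rewrite mulr0.
  - by [].
have ext : partial_hom (extend_graph G s c).
  by apply: extend_partial_hom => // n d [/= /NP [q ->] ->]; rewrite cN.
have [chi [chiB chiE]] := divisible_extension divD ext.
exists chi; split=> // [a Sa|].
  by apply: (chiE (a, 0)); apply: extend_graph_sub.
by rewrite (chiE (s, c)) //; apply: extend_graph_new.
Qed.

Section CharacterModule.
Variables (R : comNzRingType) (D : zmodType) (I : set R^o) (subI : submodule I).

Definition is_character (phi : R -> D) : Prop :=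
  (forall a b, phi (a - b) = phi a - phi b) /\ forall a, I a -> phi a = 0.

Definition character_pred : {pred R -> D} :=
  [pred phi | `[< is_character phi >]].

Fact character_zmod_closed : zmod_closed character_pred.
Proof.
split=> [|f g /asboolP [fB fI] /asboolP [gB gI]]; apply/asboolP; split=> //.
- by move=> a b; rewrite -[LHS]/(0 : D) -[RHS]/(0 - 0 : D) subr0.
- by move=> a b; rewrite !fctE fB gB !opprD !opprK addrACA.
- by move=> a Ia; rewrite !fctE fI // gI // subrr.
Qed.
HB.instance Definition _ :=
  GRing.isZmodClosed.Build (R -> D) character_pred character_zmod_closed.

Inductive character := Character phi of phi \in character_pred.
Definition character_val x := let: Character phi _ := x in phi.
HB.instance Definition _ := [isSub for character_val].
HB.instance Definition _ := [Choice of character by <:].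
HB.instance Definition _ := [SubChoice_isSubZmodule of character by <:].

Fact character_scale_subproof (a : R) (e : character) :
  (fun r => character_val e (a * r)) \in character_pred.
Proof.
case: e => phi /= /asboolP [phiB phiI]; apply/asboolP; split=> [b c|b Ib].
  by rewrite mulrBr phiB.
by apply: phiI; apply: (submodZ subI a).
Qed.

Let scale a e := Character (character_scale_subproof a e).
Let sA a b e : scale a (scale b e) = scale (a * b) e.
Proof. by apply/val_inj/funext => r /=; rewrite mulrCA mulrA. Qed.
Let s1 : left_id 1 scale.
Proof. by move=> e; apply/val_inj/funext => r /=; rewrite mul1r. Qed.
Let sDr : right_distributive scale +%R.
Proof. by move=> a e f; apply/val_inj/funext. Qed.
Let sDl e : {morph scale^~ e : a b / a + b}.
Proof.
move=> a b; apply/val_inj/funext => r; rewrite /= !fctE /=.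
case: e => phi /= /asboolP [phiB _].
have phi0 : phi 0 = 0 by rewrite -[in LHS](subrr 0) phiB subrr.
have phiN c : phi (- c) = - phi c by rewrite -[- c]sub0r phiB phi0 sub0r.
by rewrite mulrDl -[b * r in LHS]opprK phiB phiN opprK.
Qed.
(** The group Hom(R/I, D), with the action of R on the argument. *)
Definition character_module : lmodType R := HB.pack character
  (GRing.Zmodule_isLmodule.Build R character sA s1 sDr sDl).

End CharacterModule.

Section RelativelyInjective.
Variables (R : comNzRingType).

(** A linear map from G to Hom(R/I, D) amounts to an additive map from G to D,
    namely its value at 1. If this map kills the elements sent into [U], it is
    defined on the subgroup i(G) + U, vanishes on [U], and extends to F because
    [D] is divisible. *)
Lemma relatively_injective_module (I : set R^o) (s : R) :
  submodule I -> ~ I s ->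
  exists (E : lmodType R) (e0 : E), [/\ s *: e0 != 0,
    forall a (e : E), I a -> a *: e = 0 &
    forall (G F : lmodType R) (i : {linear G -> F}) (u : {linear G -> E})
        (U : set F), submodule U ->
      (forall a f, I a -> U (a *: f)) -> (forall g, U (i g) -> u g = 0) ->
      exists v : {linear F -> E}, forall g, v (i g) = u g].
Proof.
move=> subI nIs; have [D [divD torD]] := rat_mod_int.
pose E : lmodType R := character_module D subI.
have [|u v Iu Iv|chi [chiB chiI chis]] :=
  @separating_character R D I s divD torD _ _ nIs.
- exact: (submod0 subI).
- exact: (submodB subI Iu Iv).
have chi_char : chi \in @character_pred R D I by apply/asboolP; split.
have valB (e : E) a b :
  character_val e (a - b) = character_val e a - character_val e b.
  by case: e => phi /= /asboolP [].
have valI (e : E) a : I a -> character_val e a = 0.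
  by case: e => phi /= /asboolP [_]; apply.
have valZ a (e : E) r : character_val (a *: e) r = character_val e (a * r)
  by [].
have val0 r : character_val (0 : E) r = 0 by [].
have valD (e f : E) r : character_val
  (e + f) r = character_val e r + character_val f r by [].
have ext (e f : E) : (forall r, character_val e r = character_val f r) -> e = f.
  by move=> ef; apply/val_inj/funext.
exists E, (Character chi_char); split.
- apply: contraNneq chis => se0; have := valZ s (Character chi_char : E) 1.
  by rewrite se0 val0 /= mulr1 => <-.
- move=> a e Ia; apply: ext => r; rewrite valZ val0.
  by apply: valI; rewrite mulrC; apply: (submodZ subI r Ia).
move=> G F i u U subU IU Uu.
pose Gam : set (F * D) := [set p | exists g w, U w /\
  p = (i g + w, character_val (u g) 1)].
have GamP : partial_hom Gam.
  split.
  - by exists 0, 0; rewrite !linear0 addr0 val0; split=> //; apply: submod0.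
  - move=> _ _ [g [w [Uw ->]]] [g' [w' [Uw' ->]]] /=.
    exists (g - g'), (w - w'); split; first exact: submodB.
    rewrite !linearB; congr (_, _); first by rewrite opprD addrACA.
  - move=> d [g [w [Uw [igw ->]]]].
    rewrite Uu ?val0 //; have -> : i g = - w by apply/eqP;
      rewrite -addr_eq0 -igw.
    exact: submodN.
have [X [XB XG]] := divisible_extension divD GamP.
have X0 : X 0 = 0 by rewrite -[in LHS](subrr 0) XB subrr.
have XN g : X (- g) = - X g by rewrite -[- g]sub0r XB X0 sub0r.
have XD f g : X (f + g) = X f + X g by rewrite -[g in LHS]opprK XB XN opprK.
have XU w : U w -> X w = 0.
  by move=> Uw; rewrite (XG (w, 0)) //; exists 0, w;
    rewrite !linear0 add0r val0.
have v_char f : (fun r => X (r *: f)) \in @character_pred R D I.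
  by apply/asboolP; split=> [a b|a Ia];
    [rewrite scalerBl XB|by apply: XU; apply: IU].
have [|v vE] := @linear_of R F E (fun f => Character (v_char f)).
  move=> a f g; apply: ext => r; rewrite valD valZ /=.
  by rewrite scalerDr XD scalerA mulrC.
exists v => g; rewrite vE; apply: ext => r /=.
rewrite -linearZ (XG (i (r *: g), character_val (u (r *: g)) 1)); last first.
  by exists (r *: g), 0; rewrite addr0; split=> //; apply: submod0.
by rewrite /= linearZ valZ mulr1.
Qed.

End RelativelyInjective.

(** * Tensor products and projective modules *)

Section Tensors.
Variable R : comNzRingType.

Lemma bilinear_of (M N P : lmodType R) (f : M -> N -> P) :
  bilinear_for *:%R *:%R f ->
  exists g : {bilinear M -> N -> P}, forall x y, g x y = f x y.
Proof.
move=> fL; pose fM := bilinear_isBilinear.Build R M N P *:%R *:%R f fL.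
by pose g : {bilinear M -> N -> P} := HB.pack f fM; exists g.
Qed.

Local Notation "x '⊗' y" := (tensor_mk x y) (at level 40).

Lemma tensor_lift (M N P : lmodType R) (f : M -> N -> P) :
  bilinear_for *:%R *:%R f ->
  exists g : {linear tensor M N -> P}, forall x y, g (x ⊗ y) = f x y.
Proof.
move=> /bilinear_of [f' f'E].
have [g [gE _]] := tensor_is_tensor_product f'.
by exists g => x y; rewrite gE f'E.
Qed.

(** The projection of the tensor product modulo [U] kills all pure tensors, as
    the zero map does, so both agree by uniqueness in the universal property.
    *)
Lemma tensor_pure_span (M N : lmodType R) (U : set (tensor M N)) :
  submodule U -> (forall x y, U (x ⊗ y)) -> forall z, U z.
Proof.
move=> subU Uxy z; have [W [p [pS pU]]] := quotient_exists subU.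
have [|f fE] := @bilinear_of M N W (fun _ _ => 0).
  by split=> ? ? ? ?; rewrite /= scaler0 addr0.
have [g [gE gU]] := tensor_is_tensor_product f.
have [zero zeroE] : exists h : {linear tensor M N -> W}, forall x, h x = 0.
  have [|h hE] := @linear_of R (tensor M N) W (fun=> 0).
    by move=> ? ? ?; rewrite scaler0 addr0.
  by exists h => x; rewrite hE.
have pg := gU p; have zg := gU zero.
apply/pU; rewrite pg => [|x y]; last by rewrite fE; apply/pU; apply: Uxy.
by rewrite -zg // => x y; rewrite fE zeroE.
Qed.

Lemma tensor_map (E P Q : lmodType R) (f : {linear P -> Q}) :
  exists g : {linear tensor E P -> tensor E Q}, forall e p, g (e ⊗ p) = e ⊗ f p.
Proof.
apply: tensor_lift; split=> [p|e] a x y /=; first by rewrite linearPl.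
by rewrite linearP linearPr.
Qed.

Lemma tensor_mk_linear (E P : lmodType R) (e : E) :
  exists g : {linear P -> tensor E P}, forall p, g p = e ⊗ p.
Proof.
have [|g gE] := @linear_of R P (tensor E P) (fun p => e ⊗ p).
  by move=> a x y; rewrite linearPr.
by exists g => p; rewrite gE.
Qed.

Import freeg.
(** Split the canonical map from the free module on the set [P]; only the
    finitely many coordinates that occur on [ps] are kept. *)
Lemma finite_dual_basis (P : lmodType R) (ps : seq P) : projective P ->
  exists (s : seq P) (lam : P -> {linear P -> R^o}),
    {in ps, forall p, p = \sum_(q <- s) lam q p *: q}.
Proof.
move=> projP; pose W : lmodType R := {freeg P / R}.
pose q (w : W) : P := fglift idfun w.
have qB x y : q (x - y) = q x - q y by exact: lift_is_additive.
have q0 : q 0 = 0 by rewrite -[in LHS](subrr 0) qB subrr.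
have qD : {morph q : x y / x + y >-> x + y}.
  by move=> x y; rewrite -[y in LHS]opprK qB -[- y]sub0r qB q0 sub0r opprK.
have q_sum w : q w = \sum_(z <- dom w) coeff z w *: z.
  rewrite -[in LHS](freeg_sumE w) (big_morph q qD q0); apply: eq_bigr => z _.
  exact: liftU.
have [|lift liftE] := @linear_of R W P q.
  move=> a x y; rewrite qD; congr (_ + _).
  rewrite [in RHS]q_sum scaler_sumr -[a *: x]/(fgscale a x) /fgscale
    (big_morph q qD q0).
  by apply: eq_bigr => z _; rewrite /q liftU scalerA.
have [|h hK] := projP W P lift idfun.
  by move=> p; exists << p >>; rewrite liftE /q liftU scale1r.
have /boolp.choice [lam lamE] :
  forall z, exists lam : {linear P -> R^o}, forall p, lam p = coeff z (h p).
  move=> z; have [|lam lamE] := @linear_of R P R^o (fun p => coeff z (h p)).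
    by move=> a x y; rewrite linearP coeffD coeffZ.
  by exists lam.
exists (undup (flatten [seq dom (h p) | p <- ps])), lam => p pps.
rewrite -[LHS]/(idfun p) -hK liftE q_sum.
rewrite [RHS](bigID (mem (dom (h p)))) /= [X in _ = _ + X]big1 ?addr0;
  last first.
  by move=> z zp; rewrite lamE coeff_outdom // scale0r.
rewrite -[RHS]big_filter; under [RHS]eq_bigr do rewrite lamE.
apply: perm_big; apply: uniq_perm;
  [exact: uniq_dom|exact/filter_uniq/undup_uniq|].
move=> z; rewrite mem_filter mem_undup; case zp: (z \in dom (h p)) => //=.
by apply/esym/flattenP; exists (dom (h p)) => //; apply: map_f.
Qed.

End Tensors.

Section TensorExt.
Variable R : comNzRingType.
Local Notation "x '⊗' y" := (tensor_mk x y) (at level 40).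

Lemma tensor_contraction (E P : lmodType R) (lam : {linear P -> R^o}) :
  exists c : {linear tensor E P -> E}, forall e p, c (e ⊗ p) = (lam p : R) *: e.
Proof.
apply: (@tensor_lift R E P E (fun e p => (lam p : R) *: e)).
split=> [p|e] a x y /=; first by rewrite scalerDr !scalerA mulrC.
by rewrite linearP scalerDl scalerA.
Qed.

Lemma tensor_sumr (E P : lmodType R) (e : E) (I : Type) (r : seq I)
    (f : I -> P) :
  e ⊗ (\sum_(i <- r) f i) = \sum_(i <- r) e ⊗ f i.
Proof.
by have [g gE] := tensor_mk_linear P e; rewrite -gE linear_sum; apply: eq_bigr.
Qed.

Lemma tensorZr (E P : lmodType R) (a : R) (e : E) (p : P) :
  e ⊗ (a *: p) = (a *: e) ⊗ p.
Proof. by rewrite linearZr linearZl_LR. Qed.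

(** The images of the generators of [G] involve finitely many elements of [P],
    so a finite dual basis splits the map into E (x) P into finitely many maps
    into E, which extend one by one. This is Ext^1(-, E (x) P) = 0, deduced
    from Ext^1(-, E) = 0. *)
Lemma extend_into_tensor (E P G : lmodType R) k (i : {linear G -> 'rV[R]_k}) :
  finitely_generated G -> projective P ->
  (forall u : {linear G -> E},
    exists v : {linear 'rV[R]_k -> E}, forall g, v (i g) = u g) ->
  forall u : {linear G -> tensor E P},
    exists v : {linear 'rV[R]_k -> tensor E P}, forall g, v (i g) = u g.
Proof.
move=> /finitely_generatedP [n [g gS]] projP extE u.
have [C CE] := boolp.choice (@tensor_contraction E P).
pose recon (s : seq P) lam z := \sum_(q <- s) C (lam q) z ⊗ q.
have recon_lin s lam : linear (recon s lam).
  move=> a x y; rewrite /recon scaler_sumr -big_split; apply: eq_bigr => q _ /=.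
  by rewrite linearP linearPl.
have support z : exists ps : seq P, forall s (lam : P -> {linear P -> R^o}),
    {in ps, forall p, p = \sum_(q <- s) lam q p *: q} -> recon s lam z = z.
  move: z; apply: tensor_pure_span.
    split=> [|a x y [ps xps] [qs yqs]].
      exists [::] => s lam _; rewrite /recon big1 // => q _.
      by rewrite linear0 linear0l.
    exists (ps ++ qs) => s lam slam; rewrite recon_lin xps ?yqs // => p pP;
      by apply: slam; rewrite mem_cat pP ?orbT.
  move=> e p; exists [:: p] => s lam slam.
  rewrite [in RHS](slam p (mem_head _ _)) tensor_sumr; apply: eq_bigr => q _.
  by rewrite CE tensorZr.
have [ps psP] := boolp.choice (fun j => support (u (g (delta_mx 0 j)))).
have [s [lam slam]] := finite_dual_basis
  (flatten [seq ps j | j <- enum 'I_n]) projP.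
have recon_u x : recon s lam (u x) = u x.
  have [r rE] := linear_of (recon_lin s lam).
  have [y <-] := gS x; rewrite -rE row_mapE !linear_sum; apply: eq_bigr => j _.
  rewrite !linearZ /= rE psP // => p pj; apply: slam.
  by apply/flattenP; exists (ps j) => //; apply: map_f; rewrite mem_enum.
have [V VE] := boolp.choice (fun q => extE (C (lam q) \o u)).
have [|v vE] := @linear_of R 'rV[R]_k (tensor E P)
  (fun y => \sum_(q <- s) V q y ⊗ q).
  move=> a x y; rewrite scaler_sumr -big_split; apply: eq_bigr => q _ /=.
  by rewrite linearP linearPl.
by exists v => x; rewrite vE -[RHS]recon_u; apply: eq_bigr => q _; rewrite VE.
Qed.

End TensorExt.

(** * Finite projective resolutions *)

Section Resolutions.
Variable R : comNzRingType.

(** A resolution of length less than [n], cut into short exact sequences 0 -> K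
    -> P -> T -> 0, the form used by inductions on its length. *)
Fixpoint pd_lt n (T : lmodType R) : Prop :=
  if n is n'.+1 then
    exists (P K : lmodType R) (q : {linear P -> T}) (kap : {linear K -> P}),
      [/\ projective P, is_surjective q, injective kap, exact_at kap q &
        pd_lt n' K]
  else zero_module T.

Lemma kernel_exists (A B : lmodType R) (q : {linear A -> B}) :
  exists (K : lmodType R) (kap : {linear K -> A}),
    injective kap /\ exact_at kap q.
Proof.
have [|K [kap [kapI kapE]]] := @submodule_exists R A [set a | q a = 0].
  by split=> [|a x y /= qx qy];
    rewrite /= ?linear0 // linearP qx qy scaler0 addr0.
by exists K, kap; split=> // y; apply: kapE.
Qed.

Lemma resolution_pd_lt n (T : lmodType R) : has_resolution_of_length T n ->
  pd_lt n.+1 T.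
Proof.
elim: n T => [|n IHn] T [P [d [e [[projP eS de dd] Pn]]]];
  have [K [kap [kapI kape]]] := kernel_exists e;
  exists (P 0%N), K, e, kap; split=> //.
  move=> y; have [x xE] : exists x, d 0%N x = kap y by apply/de/kape; exists y.
  by apply: kapI; rewrite -xE (Pn 1%N _ x) // !linear0.
have [|e' e'E] := factor_through_inj (w := d 0%N) kapI.
  by move=> c; apply/kape/de; exists c.
apply: IHn; exists (fun i => P i.+1), (fun i => d i.+1), e'; split; last first.
  by move=> i ni; apply: Pn.
split=> // [y|y].
  have [x xE] : exists x, d 0%N x = kap y by apply/de/kape; exists y.
  by exists x; apply: kapI; rewrite e'E.
rewrite -dd -e'E; split=> [->|]; first by rewrite linear0.
by rewrite -[0](linear0 kap) => /kapI.
Qed.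

Lemma finite_pd_pd_lt (T : lmodType R) : (pd T < +oo)%E -> exists n, pd_lt n T.
Proof.
rewrite /pd; case: asboolP => [T0 _|_ Toon]; first by exists 0%N.
apply: contrapT => noT; move: Toon; rewrite /infimum ifT ?ltxx //.
apply/eqP; rewrite -subset0 => x [n Tn _]; case: noT; exists n.+1.
exact: resolution_pd_lt.
Qed.

End Resolutions.

(** * Extending maps along syzygies *)

Section Syzygies.
Variable R : comNzRingType.

Lemma add_mults_min (V : lmodType R) (U W : set V) (s : seq R) : submodule W ->
  U `<=` W -> {in s, forall a, forall w, W (a *: w)} -> add_mults U s `<=` W.
Proof.
move=> subW; rewrite /add_mults; elim: s U => [|a s IHs] U UW sW //=.
apply: IHs => [_ [u Uu [w ->]]|b bs]; last by apply: sW;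
  rewrite in_cons bs orbT.
by apply: submodD => //; [apply: UW|apply: sW; rewrite mem_head].
Qed.

Lemma add_mults_mem (V : lmodType R) (U : set V) (s : seq R) a w :
  submodule U -> a \in s -> add_mults U s (a *: w).
Proof.
rewrite /add_mults; elim: s U => [|b s IHs] U subU //=;
  rewrite in_cons => /predU1P[->|].
  by apply: (@add_mults_incl R V _ s); apply: add_mult_mul.
by apply: IHs; apply: add_mult_submodule.
Qed.

Lemma add_mults_map (V W : lmodType R) (h : {linear V -> W}) s v :
  add_mults [set 0] s v -> add_mults [set 0] s (h v).
Proof.
have subW := add_mults_submodule s (zero_submodule W).
move: v; apply: (add_mults_min (W := [set v | add_mults [set 0] s (h v)])).
- split=> [|a u v Uu Uv]; rewrite /= ?linear0 ?linearP; first exact: submod0.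
  exact: subW.2.
- by move=> _ ->; rewrite /= linear0; apply: submod0.
- by move=> a sa w; rewrite /= linearZ; apply: add_mults_mem => //;
  apply: zero_submodule.
Qed.

(** Given 0 -> G' -> F -> G -> 0, regularity on [F] and [G] gives regularity on
    [G'], and xF meets G' in xG': if g' = u + av in F, then ap(v) is zero
    modulo earlier terms, so p(v) is too, and v may be replaced by an element
    of G'. *)
Lemma weakly_regular_kernel (G' F G : lmodType R) (i : {linear G' -> F})
    (p : {linear F -> G}) (U' : set G') (U : set F) (W : set G) s :
  exact_at i p -> is_surjective p ->
  submodule U' -> submodule U -> submodule W ->
  (forall g, U (i g) <-> U' g) ->
  (forall v, W (p v) <-> exists2 u, U u & p u = p v) ->
  weakly_regular U s -> weakly_regular W s ->
  weakly_regular U' s /\ forall g, add_mults U s (i g) <-> add_mults U' s g.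
Proof.
move=> ip pS; elim: s U' U W => [|a s IHs] U' U W subU' subU subW UU' WU //=.
move=> [aU sU] [aW sW].
have pi g : p (i g) = 0 by apply/ip; exists g.
have [|||||sU' asU'] := IHs (add_mult U' a) (add_mult U a)
  (add_mult W a) _ _ _ _ _ sU sW;
  try exact: add_mult_submodule.
- move=> g; split=> [[u Uu [v igE]]|[u' Uu' [w ->]]]; last first.
    by exists (i u'); [apply/UU'|exists (i w); rewrite linearD linearZ].
  have [u' Uu' pu'] : exists2 u', U u' & p u' = p v.
    apply/WU/aW; have -> : a *: p v = - p u.
      apply/eqP; rewrite -addr_eq0 addrC -linearZ -linearD -igE; exact/eqP.
    by apply: submodN => //; apply/WU; exists u.
  have [g'' g''E] : exists g'', i g'' = v - u' by apply/ip;
    rewrite linearB pu' subrr.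
  exists (g - a *: g''); last by exists g''; rewrite subrK.
  apply/UU'; rewrite linearB linearZ g''E igE /= scalerBr opprB addrA addrAC
    addrK.
  by apply: submodD => //; apply: submodZ.
- move=> v; split=> [[y Wy [w pvE]]|[_ [u Uu [w ->]] <-]]; last first.
    by rewrite linearD linearZ; exists (p u); [apply/WU; exists u|exists (p w)].
  have [w' w'E] := pS w.
  have yE : y = p (v - a *: w') by rewrite linearB linearZ /= w'E pvE addrK.
  have [u Uu puE] : exists2 u, U u & p u = p (v - a *: w') by apply/WU;
    rewrite -yE.
  exists (u + a *: w'); first by exists u => //; exists w'.
  by rewrite linearD puE -linearD subrK.
split=> //; split=> // g Uag.
by apply/UU'/aU; rewrite -linearZ; apply/UU'.
Qed.

Lemma weakly_regular_row k (U : set R^o) s : submodule U ->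
  weakly_regular U s ->
  let Uk := fun U : set R^o => [set v : 'rV[R]_k | forall j, U (v 0 j)] in
  weakly_regular (Uk U) s /\ add_mults (Uk U) s = Uk (add_mults U s).
Proof.
move=> subU + Uk; elim: s U subU => [|a s IHs] U subU //= [aU sU].
have UkE : add_mult (Uk U) a = Uk (add_mult U a).
  apply/seteqP; split=> [_ [u Uu [w ->]] j|v vU].
    by exists (u 0 j); [apply: Uu|exists (w 0 j); rewrite !mxE].
  have /boolp.choice [w wE] : forall j, exists w : R^o, U (v 0 j - a * w).
    by move=> j; have [u Uu [w ->]] := vU j; exists w; rewrite addrK.
  exists (v - a *: \row_j w j); last by exists (\row_j w j); rewrite subrK.
  by move=> j; rewrite !mxE.
rewrite UkE; have [sUk ->] := IHs (add_mult U a) (add_mult_submodule a subU) sU.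
split=> //; split=> // v Uav j; apply: aU; have := Uav j; by rewrite mxE.
Qed.

End Syzygies.

Section Extension.
Variables (R : comNzRingType) (x : seq R) (E : lmodType R).
Hypothesis nR : noetherian_module R^o.
Hypothesis xR : weakly_regular [set (0 : R^o)] x.
Hypothesis E_annihilated : forall a (e : E), add_mults [set (0 : R^o)] x a ->
  a *: e = 0.
Hypothesis E_extension : forall (G F : lmodType R) (i : {linear G -> F})
  (u : {linear G -> E}) (U : set F), submodule U ->
  (forall a f, add_mults [set (0 : R^o)] x a -> U (a *: f)) ->
  (forall g, U (i g) -> u g = 0) ->
  exists v : {linear F -> E}, forall g, v (i g) = u g.

Local Notation "x '⊗' y" := (tensor_mk x y) (at level 40).

(** The class of modules closed under syzygies on which extensions into [E] are
    unobstructed. *)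
Definition regular_module (G : lmodType R) : Prop :=
  finitely_generated G /\ weakly_regular [set (0 : G)] x.

(** A map G' -> E kills xG', and G'/xG' -> F/xF is injective by
    [weakly_regular_kernel], so the map descends to the image of G' in F/xF and
    extends from there. *)
Lemma syzygy_regular (G G' : lmodType R) k (i : {linear G' -> 'rV[R]_k})
    (p : {linear 'rV[R]_k -> G}) :
  regular_module G -> injective i -> exact_at i p -> is_surjective p ->
  regular_module G' /\
  forall u : {linear G' -> E},
    exists v : {linear 'rV[R]_k -> E}, forall g, v (i g) = u g.
Proof.
move=> [Gfg xG] iI ip pS.
have sub0 (V : lmodType R) : submodule [set (0 : V)] := zero_submodule V.
have [xF _] := weakly_regular_row k (sub0 R^o) xR.
have row0 : [set v : 'rV[R]_k | forall j, [set (0 : R^o)] (v 0 j)] = [set 0].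
  apply/seteqP; split=> v; last by move=> -> j; rewrite mxE.
  by move=> v0; apply/rowP => j; rewrite mxE; apply: v0.
rewrite row0 in xF.
have i0 g : [set 0] (i g) <-> [set 0] g.
  by split=> [ig|->]; [apply: iI; rewrite linear0; exact: ig|exact: linear0].
have p0 v : [set 0] (p v) <-> exists2 u, [set 0] u & p u = p v.
  split=> [pv|[u -> <-]]; last exact: linear0.
  by exists 0 => //; rewrite linear0 pv.
have [xG' xG'F] := weakly_regular_kernel ip pS (sub0 _) (sub0 _)
  (sub0 _) i0 p0 xF xG.
split.
  split=> //; apply/finitely_generatedP.
  have subi : submodule [set v | exists g, i g = v].
    split=> [|a _ _ [g <-] [h <-]]; first by exists 0; rewrite linear0.
    by exists (a *: g + h); rewrite linearP.
  have [n [q qE]] := submodule_fg (noetherian_module_row (n:=k) nR) subi.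
  have [|q' q'E] := factor_through_inj (w := q) iI; first by move=> c; apply/qE;
    exists c.
  exists n, q' => g; have [c cE] : exists c, q c = i g by apply/qE; exists g.
  by exists c; apply: iI; rewrite q'E.
move=> u; apply: (E_extension (U := add_mults [set 0] x));
  first exact: add_mults_submodule.
  move=> a f xa; have [h hE] : exists h : {linear R^o -> 'rV[R]_k}, forall b,
    h b = (b : R) *: f.
    have [|h hE] := @linear_of R R^o 'rV[R]_k (fun b => (b : R) *: f).
      by move=> c y z; rewrite scalerDl scalerA.
    by exists h.
  by rewrite -hE; apply: add_mults_map.
suff kill : add_mults [set (0 : E)] x `<=` [set 0].
  by move=> g /xG'F /(add_mults_map u) /kill.
apply: (@add_mults_min R E [set 0] [set 0] x (sub0 E)) => // a xa e /=.
apply: E_annihilated; rewrite -[a]mulr1.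
exact: (@add_mults_mem R R^o _ _ a 1 (sub0 _) xa).
Qed.

(** Let 0 -> K -> P -> T -> 0 be the first step of the resolution and let F' ->
    G' be a free cover with kernel G''. Lift F' -> G' -> T to f0 : F' -> P,
    which maps G'' to K. By induction e (x) f0 on G'' extends to a map F' -> E
    (x) K; subtracting it from e (x) f0 gives a map that kills G'', hence a map
    G' -> E (x) P. This one extends to F, and the subtracted term dies in E (x)
    T. *)
Lemma extension_along_syzygy n (T : lmodType R) : pd_lt n T ->
  forall (G G' : lmodType R) k (i : {linear G' -> 'rV[R]_k})
    (p : {linear 'rV[R]_k -> G}),
  regular_module G -> injective i -> exact_at i p -> is_surjective p ->
  forall (f : {linear G' -> T}) (e : E),
  exists H : {linear 'rV[R]_k -> tensor E T}, forall g, H (i g) = e ⊗ f g.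
Proof.
elim: n T => [|n IHn] T /=.
  move=> T0 G G' k i p _ _ _ _ f e; exists \0 => g.
  by rewrite (T0 (f g)) linear0r.
move=> [P [K [q [kap [projP qS kapI kapq Kn]]]]] G G' k i p Greg iI ip pS f e.
have [G'reg extE] := syzygy_regular Greg iI ip pS.
have [l [r rS]] := (finitely_generatedP G').1 G'reg.1.
have [G'' [j [jI jr]]] := kernel_exists r.
have [f0 f0E] := row_projective (f \o r) qS.
have [|f1 f1E] := factor_through_inj (w := f0 \o j) kapI.
  move=> c; apply/kapq; rewrite f0E /=.
  by have -> : r (j c) = 0; [apply/jr; exists c|rewrite linear0].
have [H1 H1E] := IHn K Kn G' G'' l j r G'reg jI jr rS f1 e.
have [tk tkE] := tensor_map E kap; have [tq tqE] := tensor_map E q.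
have [te teE] := tensor_mk_linear P e.
have [w wE] : exists w : {linear 'rV[R]_l -> tensor E P},
    forall y, w y = te (f0 y) - tk (H1 y).
  have [|w wE] := @linear_of R 'rV[R]_l (tensor E P)
    (fun y => te (f0 y) - tk (H1 y)).
    by move=> a y z; rewrite !linearP /= scalerDr addrACA.
  by exists w.
have [|w' w'E] := factor_through_surj (w := w) rS.
  move=> y /jr [g <-]; rewrite wE H1E tkE f1E teE; exact: subrr.
have [v vE] := extend_into_tensor G'reg.1 projP extE w'.
exists (tq \o v) => g /=; rewrite vE; have [y <-] := rS g.
have tqk z : tq (tk z) = 0.
  move: z; apply: tensor_pure_span.
    split=> [|a y1 y2 /= e1 e2]; rewrite /= ?linear0 // !linearP e1 e2.
    by rewrite scaler0 addr0.
  move=> e' c /=; rewrite tkE tqE; have -> : q (kap c) = 0 by apply/kapq;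
    exists c.
  exact: linear0r.
by rewrite w'E wE linearB tqk subr0 teE tqE f0E.
Qed.

End Extension.

(** * Tensor products with a syzygy of a maximal Cohen-Macaulay module *)

Theorem theorem1p7
    (R : comNzRingType) (m : {pred R})
    (R_noeth : noetherian R) (R_local : local_ring m)
    (R_CM : cohen_macaulay_ring m)
    (M N L : lmodType R)
    (M_fg : finitely_generated M) (N_fg : finitely_generated N)
    (L_fg : finitely_generated L)
    (L_MCM : maximal_cohen_macaulay m L)
    (M_syz : is_first_syzygy M L)
    (MN : lmodType R) (t : {bilinear M -> N -> MN})
    (MN_tensor : is_tensor_product t)
    (pd_fin : (pd MN < +oo)%E) :
  zero_module M \/ zero_module N.
Proof.
have nR := noetherian_ring_module R_noeth.
have [M0|nM0] := pselect (zero_module M); [by left|right].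
apply: contrapT => nN0.
have [i [p [iI ip pS]]] := M_syz.
have im x j : i x 0 j \in m.
  by apply: (syzygy_coordinates R_local j nR L_fg pS); apply/ip; exists x.
(* if L were zero, M would be all of F, which has a vector with coordinate 1 *)
have L0 : ~ zero_module L.
  move=> L0; apply: nM0 => x; apply: iI; apply/rowP => j.
  have := syzygy_coordinates R_local j nR L_fg pS (L0 (p (delta_mx 0 j))).
  by rewrite mxE !eqxx (negPf (local_ideal_proper R_local)).
have RL : depth m R^o = depth m L by rewrite [LHS]R_CM L_MCM.
have [x [s [xR xL nxs mxs]]] := common_regular_sequence R_local nR L_fg L0 RL.
have subI := add_mults_submodule x (zero_submodule R^o).
have [E [e0 [se0 EI E_ext]]] := relatively_injective_module subI nxs.
have subm := local_ideal_submodule R_local.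
(* this submodule contains mE and not e0, and replaces mE *)
pose mE : set E := [set e | s *: e = 0].
have submE : submodule mE.
  split=> [|a u v /= su sv]; first by rewrite /mE /= scaler0.
  by rewrite /mE /= scalerDr scalerA mulrC -scalerA su sv scaler0 addr0.
have mEP r e : r \in m -> mE (r *: e).
  by move=> rm; rewrite /mE /= scalerA mulrC; apply/EI/mxs.
have [Q [rho [rhoS rhoE]]] := quotient_exists submE.
have rho_m r e : r \in m -> rho (r *: e) = 0 by move=> /mEP ?; apply/rhoE.
have [phi [philin [x0 phix0]]] := residue_coordinate R_local nR M_fg nM0.
have [psi [psilin [y0 psiy0]]] := residue_coordinate R_local nR N_fg nN0.
have rho_lin (V : lmodType R) (h : V -> R) :
    (forall a v w, h (a *: v + w) - (a * h v + h w) \in m) ->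
  forall a v w c e, rho ((h (a *: v + w) * c) *: e) =
    a *: rho ((h v * c) *: e) + rho ((h w * c) *: e).
  move=> hlin a v w c e.
  apply/eqP; rewrite -subr_eq0 -linearP -linearB; apply/eqP.
  rewrite -(rho_m _ (c *: e) (hlin a v w)); congr (rho _).
  by rewrite !scalerA mulrBl mulrDl scalerBl scalerDl mulrA.
have bil e : exists b : {bilinear M -> N -> Q},
    forall y z, b y z = rho ((phi y * psi z) *: e).
  apply: bilinear_of; split=> [z|y] a u v /=; first exact: rho_lin.
  by rewrite ![phi y * _]mulrC; apply: rho_lin.
have /boolp.choice [B BE] : forall e, exists B : {linear MN -> Q},
    forall y z, B (t y z) = rho ((phi y * psi z) *: e).
  move=> e; have [b bE] := bil e; have [B [BE _]] := MN_tensor Q b.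
  by exists B => y z; rewrite BE bE.
have B_unique e (h : MN -> Q) : linear h ->
    (forall y z, h (t y z) = rho ((phi y * psi z) *: e)) -> h =1 B e.
  move=> /linear_of [h' h'E] hE tau.
  have [b bE] := bil e; have [g [_ gU]] := MN_tensor Q b.
  rewrite -h'E (gU h') => [|y z]; last by rewrite h'E hE bE.
  by rewrite (gU (B e)) // => y z; rewrite BE bE.
have [|beta betaE] := @tensor_lift R E MN Q (fun e tau => B e tau).
  split=> [tau|e] a u v /=; last by rewrite linearP.
  apply/esym; move: tau; apply: B_unique => [c y z|y z].
    by rewrite ![_ (c *: y + z)]linearP !scalerDr !scalerA [a * c]mulrC addrACA.
  by rewrite /= !BE -linearP !scalerA scalerDr !scalerA mulrC.
have [f fE] : exists f : {linear M -> MN}, forall y, f y = t y y0.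
  have [|f fE] := @linear_of R M MN (fun y => t y y0); last by exists f.
  by move=> a u v; rewrite linearPl.
have [n MNn] := finite_pd_pd_lt pd_fin.
have [H HE] := extension_along_syzygy nR xR EI E_ext MNn
  (conj L_fg xL) iI ip pS f e0.
have := HE x0; move/(congr1 beta); rewrite betaE fE BE.
rewrite row_mapE linear_sum big1 => [|j _]; last first.
  have [e eE] := rhoS (beta (H (delta_mx 0 j))).
  by rewrite linearZ /= -eE -linearZ; apply: rho_m.
have [b phib] := local_unit R_local nR phix0.
have [c psic] := local_unit R_local nR psiy0.
move/esym/rhoE => /= su; move/eqP: se0; apply.
have -> : e0 = (b * c) *: ((phi x0 * psi y0) *: e0).
  by rewrite scalerA [b * c * _]mulrC mulrACA phib psic mul1r scale1r.
by rewrite scalerA [s * _]mulrC -[(_ * s) *: _]scalerA su scaler0.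
Qed.
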